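(* Let $m\geq 1$. A $2^m\times 2^m$ complex matrix $U$ can be exactly represented by an $m$-qubit circuit over $\mathcal{G}_{16}$ (possibly using ancillas) if and only if $U$ is unitary with all entries in $\mathcal{R}_{16}$. Furthermore, a single ancilla suffices to synthesize a circuit for such a $U$.
   Context: For $n$ divisible by 8, let $\zeta_n=e^{2\pi i/n}$ and let $\mathcal{G}_n$ be the gate set consisting of $H=\frac{1}{\sqrt2}\begin{bmatrix}1&1\\1&-1\end{bmatrix}$, $S=\mathrm{diag}(1,i)$, the two-qubit controlled-not $CX$, and $T_n=\mathrm{diag}(1,\zeta_n)$. $\mathcal{R}_n$ denotes the smallest subring of $\mathbb{C}$ containing $1/2$ and $\zeta_n$. An $m$-qubit unitary $U$ is exactly represented by a circuit over $\mathcal{G}_n$ using $a$ ancillas if there is a circuit $C$ over $\mathcal{G}_n$ on $m+a$ qubits such that $C(\mathbf{u}\otimes \mathbf{e}_0)=(U\mathbf{u})\otimes\mathbf{e}_0$ for every $\mathbf{u}\in\mathbb{C}^{2^m}$, where $\mathbf{e}_0$ is the all-zero computational basis state of the $a$ ancilla qubits. *)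

(* Defs.v *)
From Stdlib Require Import Reals.
From mathcomp Require Import all_boot all_algebra.
From mathcomp Require Import complex Rstruct.
Set Implicit Arguments. Unset Strict Implicit. Unset Printing Implicit Defensive.
Import GRing.Theory Num.Theory.
Local Open Scope ring_scope.

Definition CC := R[i].

Definition zeta (n : nat) : CC :=
  Complex (cos (2 * PI / INR n))%R (sin (2 * PI / INR n))%R.

Definition in_Rn (n : nat) (x : CC) : Prop :=
  forall S : {pred CC}, GRing.subring_closed S ->
    (1 / 2 : CC) \in S -> zeta n \in S -> x \in S.

Definition bit (j x : nat) : bool := odd (x %/ 2 ^ j).

Definition H_gate (b c : bool) : CC :=
  let h : CC := Complex (sqrt 2)^-1 0 in if b && c then - h else h.
Definition S_gate (b c : bool) : CC :=
  if b == c then (if b then Complex 0 1 else 1) else 0.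
Definition T_gate (n : nat) (b c : bool) : CC :=
  if b == c then (if b then zeta n else 1) else 0.

Definition embed1 (k : nat) (G : bool -> bool -> CC) (q : 'I_k) : 'M[CC]_(2 ^ k) :=
  \matrix_(x, y)
    if [forall j : 'I_k, (j != q) ==> (bit j x == bit j y)]
    then G (bit q x) (bit q y) else 0.

Definition embedCX (k : nat) (c t : 'I_k) : 'M[CC]_(2 ^ k) :=
  \matrix_(x, y)
    if [forall j : 'I_k, (j != t) ==> (bit j x == bit j y)]
       && (bit t x == bit t y (+) bit c y)
    then 1 else 0.

Inductive gate (k : nat) : Type :=
  | GH of 'I_k
  | GS of 'I_k
  | GT of 'I_k
  | GCX (c t : 'I_k) of c != t.

Definition gate_mx (n k : nat) (g : gate k) : 'M[CC]_(2 ^ k) :=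
  match g with
  | GH q => embed1 H_gate q
  | GS q => embed1 S_gate q
  | GT q => embed1 (T_gate n) q
  | GCX c t _ => embedCX c t
  end.

(* A circuit is a list of gates, applied from the head of the list onwards. *)
Definition circuit (k : nat) := seq (gate k).

Definition circuit_mx (n k : nat) (cir : circuit k) : 'M[CC]_(2 ^ k) :=
  foldr (fun g M => M *m gate_mx n g) 1%:M cir.

(* Basis index decomposition x = u * 2^a + r with u the data part
   (first m qubits, high bits) and r the ancilla part (last a qubits). *)
Lemma hi_idx_proof (m a : nat) (x : 'I_(2 ^ (m + a))) : (x %/ 2 ^ a < 2 ^ m)%N.
Proof.
by rewrite ltn_divLR ?expn_gt0 // -expnD.
Qed.

Definition hi_idx (m a : nat) (x : 'I_(2 ^ (m + a))) : 'I_(2 ^ m) :=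
  Ordinal (hi_idx_proof x).

Definition tens_e0 (m a : nat) (v : 'cV[CC]_(2 ^ m)) : 'cV[CC]_(2 ^ (m + a)) :=
  \col_x (if (x %% 2 ^ a == 0)%N then v (hi_idx x) 0 else 0).

Definition represented_with (n m a : nat) (U : 'M[CC]_(2 ^ m)) : Prop :=
  exists cir : circuit (m + a),
    forall u : 'cV[CC]_(2 ^ m),
      circuit_mx n cir *m tens_e0 a u = tens_e0 a (U *m u).

Definition unitary (k : nat) (U : 'M[CC]_k) : Prop :=
  U *m (map_mx (@conjc R) U)^T = 1%:M.
Arguments represented_with n m a U : clear implicits.

(* Main.v *)
(* Write w = zeta^2, lam = 1 - w and R16 = R8 + zeta R8 with R8 = Z[w, 1/2]. A unitary
   U = A + zeta B over R16 is replaced by the unitary A (x) I + B (x) L over R8, where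
   L = [0, 1; w, 0] acts on the ancilla: since L (1, zeta) = zeta (1, zeta), it applies U to
   the data while preserving the catalyst (1, zeta) / sqrt 2, which is T H e_0. Over R8 a
   column is reduced by the determinant 1 two-level matrices
   [1, w^s; -w^-s, 1] / sqrt 2 ("mixers"): any two entries prime to lam agree modulo lam^3
   up to a power of w, so one mixer makes both divisible by lam, and a column with
   integral entries is a power of w times a basis vector. A mixer needs no further ancilla: it
   is conjugate to a fully controlled diag(w, w^-1), which is the commutator of a controlled X
   and a controlled T^2. The one-level phase left over by the reduction cannot be obtained
   from mixers for determinant reasons; on catalysed states it is traded for a one-level power
   of zeta on the data, which is synthesised with the ancilla in the state 0. *)
Require Import Defs.
From Stdlib Require Import Reals.
From mathcomp Require Import all_boot all_algebra.
From mathcomp Require Import complex Rstruct.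
From mathcomp Require Import boolp ring lra zify.
Import GRing.Theory Num.Theory.
Local Open Scope ring_scope.

(** Determinants shape the proof. On five or more qubits every gate has determinant 1, so neither a
    nontrivial one-level phase nor a Z controlled by all other qubits is a circuit there, and the
    only ancilla is busy holding the catalyst. Hence the reduction uses determinant 1 matrices only,
    and gates with many controls borrow an idle qubit in an unknown state. Why modulo [lam ^+ 3]: 2
    is a unit times [lam ^+ 4] and 1/√2 a unit times [lam ^- 2], so a mixer loses two factors [lam]
    where the congruence supplies three, a net gain of one. The embedding is unitary because 1 and
    [z16] are independent over [R8]: the unitarity of [A + z16 B] can then be compared coefficient
    by coefficient. Why [z16 ^+ (3 * s)]: let [z16 ^+ p] compensate [w ^+ s]. On the two levels over
    [u], a diagonal of determinant 1 does it if [p] is even and [w ^+ (s + p) = 1], a phased swap if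
    [p] is odd and [w ^+ (s + p) = -1]. As [w ^+ (4 * s)] is 1 or -1 with the parity of [s],
    [p = 3 * s] always fits. *)

Local Notation z16 := (zeta 16).
Local Notation rt2 := (sqrt 2).

(** * The eighth root of unity w and its integers *)

Lemma rt2_sq : rt2 ^+ 2 = 2 :> R.
Proof.
have -> : rt2 ^+ 2 = Rmult (sqrt 2) (sqrt 2) by rewrite expr2.
by rewrite sqrt_sqrt //; apply: Rlt_le; exact: Rlt_0_2.
Qed.

Lemma rt2_neq0 : rt2 != 0 :> R.
Proof. by apply/eqP => h; move: rt2_sq; rewrite h expr0n /= => /eqP; rewrite eq_sym pnatr_eq0. Qed.

(* Locked so that rewriting does not see through [w] to a power of [zeta 16]. *)
Definition w : CC := locked (z16 ^+ 2).

Lemma wE : w = z16 ^+ 2.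
Proof. by rewrite /w -lock. Qed.

Definition hf : CC := Complex rt2^-1 0.
Definition lam : CC := 1 - w.

Lemma zeta16_angle (x : R) : Complex (cos x) (sin x) ^+ 2 = Complex (cos (2 * x)) (sin (2 * x)) :> CC.
Proof.
rewrite expr2 cos_2a sin_2a; apply/eqP; rewrite eq_complex /= ; apply/andP; split; apply/eqP.
  by [].
rewrite -[X in _ = Rmult (Rmult X _) _]/(2%:R : R).
change (cos x * sin x + sin x * cos x = 2%:R * sin x * cos x :> R); ring.
Qed.

Lemma w_coord : w = Complex rt2^-1 rt2^-1.
Proof.
rewrite wE /zeta zeta16_angle.
have -> : Rmult (IZR 2) (Rdiv (Rmult (IZR 2) PI) (INR 16)) = Rdiv PI (IZR 4).
  by rewrite !RdivE !RmultE !IZRposE !INRE /=; field.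
rewrite cos_PI4 sin_PI4.
by rewrite /Rdiv Rmult_1_l.
Qed.

Lemma w2 : w ^+ 2 = Complex 0 1.
Proof.
rewrite w_coord expr2; apply/eqP; rewrite eq_complex /=; apply/andP; split; apply/eqP.
  by rewrite subrr.
have e := rt2_sq.
suff : rt2^-1 * rt2^-1 = 2^-1 :> R by move=> ->; lra.
by rewrite -invfM -expr2 e.
Qed.

Lemma w4 : w ^+ 4 = -1.
Proof.
rewrite (exprM _ 2 2) w2 expr2; apply/eqP; rewrite eq_complex /=.
by apply/andP; split; apply/eqP; rewrite ?mulr1 ?mul0r ?mulr0 ?oppr0 ?addr0 ?sub0r.
Qed.

Lemma w_neq0 : w != 0.
Proof. by apply/eqP => h; move: w4; rewrite h expr0n => /eqP; rewrite eq_sym oppr_eq0 oner_eq0. Qed.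

Lemma w8 : w ^+ 8 = 1.
Proof. by rewrite (exprM _ 4 2) w4 sqrrN expr1n. Qed.

Lemma z16_16 : z16 ^+ 16 = 1.
Proof. by rewrite (exprM _ 2 8) -wE w8. Qed.

Lemma z16_neq0 : z16 != 0.
Proof. by apply/eqP => h; move: w_neq0; rewrite wE h expr0n eqxx. Qed.

(** Both sides are √2, which therefore lies in [Z[w]]; this puts [hf] into [Z[w, 1/2]]. *)
Lemma hf_w : w - w ^+ 3 = 2 * hf.
Proof.
rewrite exprSr w2 w_coord /hf; apply/eqP; rewrite eq_complex /=; apply/andP; split; apply/eqP; lra.
Qed.

Lemma two_neq0 : (2 : CC) != 0. Proof. by rewrite pnatr_eq0. Qed.

Lemma hfE : hf = (w - w ^+ 3) / 2.
Proof. by rewrite hf_w mulrC mulKf // two_neq0. Qed.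

Lemma hf2 : hf * hf = 1 / 2.
Proof.
by rewrite hfE; field: w4; rewrite ?two_neq0.
Qed.

Lemma hf_sq_sum : hf * hf + hf * hf = 1.
Proof. by rewrite hf2 -mulrDl -[1 + 1]/(2 : CC) mulfV ?two_neq0. Qed.

Lemma conj_zeta16 : z16 * conjc z16 = 1.
Proof.
have := sin2_cos2 (2 * PI / INR 16)%R; rewrite /zeta /Rsqr => e.
apply/eqP; rewrite eq_complex /=; apply/andP; split; apply/eqP.
  by rewrite -[RHS]e mulrN opprK addrC.
by rewrite mulrN mulrC addNr.
Qed.

Lemma conj_z16 : conjc z16 = z16 ^-1.
Proof. by rewrite -[RHS]mulr1 -conj_zeta16 mulKf // z16_neq0. Qed.

Lemma conj_w : conjc w = w ^-1.
Proof. by rewrite wE rmorphXn -exprVn -conj_z16. Qed.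

Lemma wV : w ^-1 = - w ^+ 3.
Proof. by apply: (mulfI w_neq0); rewrite mulfV ?w_neq0 // mulrN -exprS w4 opprK. Qed.

Arguments zeta : simpl never.
Arguments conjc : simpl never.
Arguments w : simpl never.

Lemma conj_hf : conjc hf = hf.
Proof. by rewrite /hf /conjc oppr0. Qed.

(** * Integer coordinates and norm form of [Z[w]] *)

(** For nonzero [b] the 2-adic valuation is even on the left and odd on the right. *)
Lemma sqrt2_irrational (a b : int) : a ^+ 2 = 2 * b ^+ 2 -> b = 0.
Proof.
move=> e; apply/eqP; apply/negPn/negP => b0.
have a0 : a != 0 by apply/eqP => a0; move: e => /eqP;
  rewrite a0 expr0n eq_sym mulf_eq0 /= sqrf_eq0 (negbTE b0).
have : (`|a| ^ 2 = 2 * `|b| ^ 2)%N by rewrite -abszX e abszM abszX.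
move/(congr1 (logn 2)); rewrite lognM ?expn_gt0 ?absz_gt0 ?b0 // !lognX /=.
by move/(congr1 odd); rewrite oddD !mul2n !odd_double.
Qed.

Lemma sqrt2_lin_indep (a b : int) : a%:~R + b%:~R * rt2 = 0 :> R -> a = 0 /\ b = 0.
Proof.
move=> e; have /sqrt2_irrational b0 : a ^+ 2 = 2 * b ^+ 2.
  apply/eqP; rewrite -(eqr_int R) intrM !rmorphXn /=.
  have /(congr1 (fun x => x ^+ 2)) : a%:~R = - (b%:~R * rt2) :> R by apply/eqP; rewrite -addr_eq0 e.
  by rewrite sqrrN exprMn rt2_sq mulrC => ->.
split=> //; move: e => /eqP; rewrite b0 mul0r addr0 intr_eq0 => /eqP //.
Qed.

Definition zw4 (a b c d : int) : CC :=
  a%:~R + b%:~R * w + c%:~R * w ^+ 2 + d%:~R * w ^+ 3.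

Lemma zw4D a b c d a' b' c' d' :
  zw4 a b c d + zw4 a' b' c' d' = zw4 (a + a') (b + b') (c + c') (d + d').
Proof. rewrite /zw4 !rmorphD /=; ring. Qed.

Lemma zw4M a b c d a' b' c' d' :
  zw4 a b c d * zw4 a' b' c' d' =
  zw4 (a * a' - b * d' - c * c' - d * b') (a * b' + b * a' - c * d' - d * c')
    (a * c' + b * b' + c * a' - d * d') (a * d' + b * c' + c * b' + d * a').
Proof. rewrite /zw4 !(rmorphD, rmorphB, rmorphM) /=; ring: w4. Qed.

Lemma intr_CC (a : int) : a%:~R = Complex a%:~R 0 :> CC.
Proof. by rewrite -[RHS]/(real_complex R a%:~R) rmorph_int. Qed.

Lemma zw4_coord a b c d : zw4 a b c d =
  Complex (a%:~R + (b - d)%:~R * rt2^-1) (c%:~R + (b + d)%:~R * rt2^-1).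
Proof.
rewrite /zw4 (exprSr w 2) w2 w_coord !intr_CC; apply/eqP; rewrite eq_complex /= !(rmorphD, rmorphB) /=.
apply/andP; split; apply/eqP; ring.
Qed.

Lemma rt2_div (a b : int) : a%:~R + b%:~R * rt2^-1 = 0 :> R -> a = 0 /\ b = 0.
Proof.
move=> /(congr1 (fun x => x * 2)); rewrite mul0r -[X in _ * X = _]rt2_sq mulrDl.
have -> : a%:~R * rt2 ^+ 2 + b%:~R / rt2 * rt2 ^+ 2 = (a * 2)%:~R + b%:~R * rt2 :> R.
  by rewrite intrM -[X in _ = _ * X + _]rt2_sq; field; rewrite rt2_neq0.
by move/sqrt2_lin_indep => [/eqP]; rewrite mulf_eq0 orbF => /eqP -> ->.
Qed.

(** Real and imaginary parts vanish separately, and 1 and 1/√2 are independent over the integers;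
    this leaves [b - d = 0] and [b + d = 0]. *)
Lemma zw4_inj0 a b c d : zw4 a b c d = 0 -> [/\ a = 0, b = 0, c = 0 & d = 0].
Proof.
rewrite zw4_coord => -[/rt2_div[a0 e] /rt2_div[c0 e']].
by split; lia.
Qed.

Definition Zw (x : CC) := exists a b c d, x = zw4 a b c d.

Lemma Zw_int (a : int) : Zw a%:~R.
Proof. by exists a, 0, 0, 0; rewrite /zw4 !mul0r !addr0. Qed.

Lemma Zw0 : Zw 0. Proof. exact: (Zw_int 0). Qed.
Lemma Zw1 : Zw 1. Proof. exact: (Zw_int 1). Qed.

Lemma Zww : Zw w.
Proof. by exists 0, 1, 0, 0; rewrite /zw4 !mul0r !addr0 mul1r add0r. Qed.

Lemma ZwD x y : Zw x -> Zw y -> Zw (x + y).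
Proof.
by move=> [a [b [c [d ->]]]] [a' [b' [c' [d' ->]]]]; rewrite zw4D; do 4!eexists.
Qed.

Lemma ZwM x y : Zw x -> Zw y -> Zw (x * y).
Proof.
by move=> [a [b [c [d ->]]]] [a' [b' [c' [d' ->]]]]; rewrite zw4M; do 4!eexists.
Qed.

Lemma ZwN x : Zw x -> Zw (- x).
Proof. by move=> h; rewrite -mulN1r; apply: ZwM => //; exact: (Zw_int (-1)). Qed.

Lemma ZwB x y : Zw x -> Zw y -> Zw (x - y).
Proof. by move=> hx hy; apply: ZwD => //; apply: ZwN. Qed.

Lemma ZwX x k : Zw x -> Zw (x ^+ k).
Proof. by move=> h; elim: k => [|k IH]; [exact: Zw1|rewrite exprS; apply: ZwM]. Qed.

Lemma Zw_wX k : Zw (w ^+ k). Proof. exact: ZwX Zww. Qed.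

Lemma Zw_conj x : Zw x -> Zw (conjc x).
Proof.
have hc : Zw (conjc w) by rewrite conj_w wV; apply: ZwN; exact: Zw_wX.
move=> [a [b [c [d ->]]]]; rewrite /zw4 !(rmorphXn, rmorphD, rmorphM, rmorph_int).
by do ![apply: ZwD|apply: ZwM|apply: ZwX|exact: Zw_int| exact: hc].
Qed.

(** What matters later is that the rational part of this element of [Z[√2]] is a positive definite
    form in the coordinates. *)
Lemma zw4_norm a b c d : zw4 a b c d * conjc (zw4 a b c d) =
  Complex ((a^+2 + b^+2 + c^+2 + d^+2)%:~R + (a * b + b * c + c * d - d * a)%:~R * rt2) 0.
Proof.
have n := rt2_neq0; have e := rt2_sq.
rewrite zw4_coord; apply/eqP; rewrite eq_complex /= !(rmorphD, rmorphB, rmorphM, rmorphXn) /=.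
apply/andP; split; apply/eqP; field: e => //.
Qed.

(** * The prime lam above 2 and the ring R8 = Z[w, 1/2] *)

Lemma lam_pow4 : lam ^+ 4 = 2 * (- 2 * w + 3 * w ^+ 2 - 2 * w ^+ 3).
Proof. by rewrite /lam; ring: w4. Qed.

(** The cofactor is the inverse in [Z[w]] of the unit in [lam_pow4], found from
    [(A + B) * (A - B) = 1] with [A = - 2 * w - 2 * w ^+ 3] and [B = 3 * w ^+ 2]. *)
Lemma two_lam : 2 = lam ^+ 4 * (- 2 * w - 3 * w ^+ 2 - 2 * w ^+ 3).
Proof. by rewrite /lam; ring: w4. Qed.

Lemma lam_sq : lam ^+ 2 * hf = w - w ^+ 2 - 1.
Proof. by rewrite hfE /lam; field: w4; rewrite ?two_neq0. Qed.

Lemma Zw_nat (n : nat) : Zw n%:R.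
Proof. exact: (Zw_int n). Qed.

Ltac solve_Zw := do ![exact: Zw_int | exact: Zw_nat | exact: Zw0 | exact: Zw1 | exact: Zww | assumption
  | apply: ZwD | apply: ZwN | apply: ZwM | apply: ZwX].

Lemma Zw_lam : Zw lam. Proof. rewrite /lam; solve_Zw. Qed.

Lemma lam_neq0 : lam != 0.
Proof. by apply/eqP => h; move/eqP: two_lam; rewrite h expr0n mul0r (negbTE two_neq0). Qed.

(** The residue field is F_2: since [w] is 1 modulo [lam], [zw4 a b c d] is congruent to
    [a + b + c + d], and [lam] divides 2. *)
Lemma Zw_mod_lam x : Zw x -> exists (e : bool) y, Zw y /\ x = e%:R + lam * y.
Proof.
move=> [a [b [c [d ->]]]].
have [e [q hn]] : exists (e : bool) q, a + b + c + d = e%:Z + 2 * q.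
  by exists (odd `|(a + b + c + d)%R|), ((a + b + c + d) %/ 2)%Z; lia.
have := two_lam; set u := (X in _ * X) => e2.
exists e, (lam ^+ 3 * u * q%:~R - b%:~R - c%:~R * (1 + w) - d%:~R * (1 + w + w ^+ 2)).
split; first by rewrite /u; move: Zw_lam => ?; solve_Zw.
have -> : a = e%:Z + 2 * q - b - c - d by lia.
rewrite /zw4 !(rmorphD, rmorphB, rmorphM) /= -pmulrn.
have -> : w = 1 - lam by rewrite /lam; ring.
by move: u e2 => u e2; ring: e2.
Qed.

(** Comparing coordinates would force [a = b = c = d] and [a + d = 1], impossible by parity. *)
Lemma lam_nunit y : Zw y -> lam * y <> 1.
Proof.
move=> [a [b [c [d ->]]]] /eqP; rewrite -subr_eq0 => /eqP e.
have : zw4 (a + d - 1) (b - a) (c - b) (d - c) = 0.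
  by rewrite -e /zw4 /lam !(rmorphD, rmorphB) /=; ring: w4.
by move/zw4_inj0 => -[]; lia.
Qed.

(** There are four classes prime to [lam] modulo [lam ^+ 3], namely [1 + e lam + e' lam^2] with bits
    [e], [e']. Expanding [w = 1 - lam] with 2 equal to 0 shows that [w ^+ 0], ..., [w ^+ 3] hit each
    of them once. *)
Lemma odd_mod_lam3 x : Zw x ->
  exists s y, Zw y /\ 1 + lam * x = w ^+ s + lam ^+ 3 * y.
Proof.
move=> /Zw_mod_lam[e [x1 [/Zw_mod_lam[e' [x2 [h2 ->]]] ->]]].
set u := - 2 * w - 3 * w ^+ 2 - 2 * w ^+ 3.
have hu : Zw u by rewrite /u; solve_Zw.
case: e e' => -[]; rewrite ?(mulr1n, mulr0n).
- exists 3%N, (x2 + lam ^+ 2 * u * (2 - lam) + 1); split.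
    by rewrite /u /lam; solve_Zw.
  have -> : w = 1 - lam by rewrite /lam; ring.
  apply/eqP; rewrite -subr_eq0; apply/eqP;
    transitivity ((2 - lam ^+ 4 * u) * (2 * lam - lam ^+ 2)); first by ring.
  by rewrite -two_lam subrr mul0r.
- exists 1%N, (x2 + lam ^+ 2 * u); split; first by rewrite /lam; solve_Zw.
  have -> : w ^+ 1 = 1 - lam by rewrite /lam; ring.
  apply/eqP; rewrite -subr_eq0; apply/eqP; transitivity ((2 - lam ^+ 4 * u) * lam); first by ring.
  by rewrite -two_lam subrr mul0r.
- exists 2%N, (x2 + lam ^+ 2 * u); split; first by rewrite /lam; solve_Zw.
  have -> : w = 1 - lam by rewrite /lam; ring.
  apply/eqP; rewrite -subr_eq0; apply/eqP; transitivity ((2 - lam ^+ 4 * u) * lam); first by ring.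
  by rewrite -two_lam subrr mul0r.
- by exists 0%N, x2; split=> //; ring.
Qed.

Lemma odd_pair x y : Zw x -> Zw y ->
  exists s z, Zw z /\ 1 + lam * x = w ^+ s * (1 + lam * y) + lam ^+ 3 * z.
Proof.
move=> /odd_mod_lam3[s [x' [hx ->]]] /odd_mod_lam3[t [y' [hy ->]]].
(* As [w ^+ 8 = 1], the natural exponent [7 * t] stands for [- t], here and in all later phases. *)
exists (s + t * 7)%N, (x' - w ^+ (s + t * 7) * y'); split.
  by apply: ZwB => //; apply: ZwM => //; exact: Zw_wX.
have -> : w ^+ s = w ^+ (s + t * 7) * w ^+ t.
  by rewrite -exprD -addnA -mulnSr mulnC exprD exprM w8 expr1n mulr1.
ring.
Qed.

(** Inverting [lam] is the same as inverting 2, the two having associated powers; the exponent [k]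
    is the measure of the column reduction. *)
Definition R8 (x : CC) := exists k, Zw (lam ^+ k * x).

Lemma Zw_R8 x : Zw x -> R8 x. Proof. by exists 0%N; rewrite mul1r. Qed.

Lemma R8_le {x k} l : (k <= l)%N -> Zw (lam ^+ k * x) -> Zw (lam ^+ l * x).
Proof. by move=> /subnK<-; rewrite exprD -mulrA => h; apply: ZwM => //; apply: ZwX Zw_lam. Qed.

Lemma R8D x y : R8 x -> R8 y -> R8 (x + y).
Proof.
move=> [k hk] [l hl]; exists (k + l)%N; rewrite mulrDr; apply: ZwD.
  exact: R8_le (leq_addr _ _) hk.
exact: R8_le (leq_addl _ _) hl.
Qed.

Lemma R8M x y : R8 x -> R8 y -> R8 (x * y).
Proof. by move=> [k hk] [l hl]; exists (k + l)%N; rewrite exprD mulrACA; apply: ZwM. Qed.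

Lemma R8N x : R8 x -> R8 (- x).
Proof. by move=> [k hk]; exists k; rewrite mulrN; apply: ZwN. Qed.

Lemma R8_sum (I : Type) (r : seq I) (P : pred I) (F : I -> CC) :
  (forall i, P i -> R8 (F i)) -> R8 (\sum_(i <- r | P i) F i).
Proof. by move=> h; elim/big_ind: _ => //; [exact: Zw_R8 Zw0|exact: R8D]. Qed.

Lemma R8_half : R8 (1 / 2).
Proof.
exists 4%N; rewrite lam_pow4.
have -> : forall v : CC, 2 * v * (1 / 2) = v by move=> v; rewrite mul1r mulrAC mulfV ?two_neq0 ?mul1r.
solve_Zw.
Qed.

Lemma R8_hf : R8 hf.
Proof.
rewrite hfE -[_ ^-1]mul1r; apply: R8M R8_half; apply: Zw_R8; apply: ZwB; solve_Zw.
Qed.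

Lemma conjcM (x y : CC) : conjc (x * y) = conjc x * conjc y. Proof. exact: rmorphM. Qed.
Lemma conjcD (x y : CC) : conjc (x + y) = conjc x + conjc y. Proof. exact: rmorphD. Qed.
Lemma conjcX (x : CC) n : conjc (x ^+ n) = conjc x ^+ n. Proof. exact: rmorphXn. Qed.
Lemma conjcN (x : CC) : conjc (- x) = - conjc x. Proof. exact: rmorphN. Qed.

Lemma conj_lam : conjc lam = w ^+ 3 * lam.
Proof. by rewrite /lam conjcD conjcN conj_w wV rmorph1; ring: w4. Qed.

Lemma R8_conj x : R8 x -> R8 (conjc x).
Proof.
move=> [k /Zw_conj]; rewrite conjcM conjcX conj_lam => h; exists k.
have -> : lam ^+ k * conjc x = w ^+ (5 * k) * ((w ^+ 3 * lam) ^+ k * conjc x).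
  by rewrite exprM mulrA -exprMn mulrA -exprD w8 mul1r.
by apply: ZwM => //; exact: Zw_wX.
Qed.

(** * Independence of 1 and [z16] over [R8] *)

Lemma hf_rt2 : 2 * hf = Complex rt2 0.
Proof.
have e := rt2_sq; have n := rt2_neq0.
rewrite /hf; apply/eqP; rewrite eq_complex /=; apply/andP; split; apply/eqP; field: e => //.
Qed.

(** The half-angle formula, read off the real part of [w = z16 ^+ 2]. *)
Lemma cos_pi8 : exists c s : R, z16 = Complex c s /\ 2 * c ^+ 2 = 1 + rt2^-1.
Proof.
have key t : w = Complex (cos t) (sin t) ^+ 2 -> 2 * cos t ^+ 2 = 1 + rt2^-1.
  rewrite w_coord expr2 => -[h _].
  have h2 : sin t * sin t + cos t * cos t = 1 :> R by exact: sin2_cos2.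
  rewrite h -[X in _ = X + _]h2; ring.
by exists (cos (2 * PI / INR 16)), (sin (2 * PI / INR 16)); split=> //; apply: key; rewrite wE.
Qed.

(** Otherwise some nonzero integer multiple of [z16] lies in [Z[w]], so cos(π/8) lies in Q(√2),
    which its square [(1 + 1/√2) / 2] excludes. *)
Lemma z16_notin_frac x y : Zw x -> Zw y -> x + z16 * y = 0 -> y = 0.
Proof.
move=> hx hy e; apply/eqP; apply/negPn/negP => y0.
case: (hy) => a [b [c [d Ey]]].
have := zw4_norm a b c d; rewrite -Ey.
move: (_ + _ + _ + _) (_ - _) => A B N.
pose r : CC := 2 * hf.
have hr : Zw r by rewrite /r -hf_w; apply: ZwB; solve_Zw.
(* [n] is the norm of [y] down to the integers: [y * conjc y = A + B √2], multiplied by its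
   conjugate [A - B √2]. This clears the denominator [y]. *)
pose n := A ^+ 2 - 2 * B ^+ 2.
have En : y * (conjc y * (A%:~R - B%:~R * r)) = n%:~R.
  rewrite mulrA N !intr_CC /r hf_rt2; have e2 := rt2_sq.
  rewrite /n !(rmorphB, rmorphM, rmorphXn) /=.
  by apply/eqP; rewrite eq_complex /=; apply/andP; split; apply/eqP; ring: e2.
have n0 : n != 0.
  apply/eqP => n0.
  have /sqrt2_irrational B0 : A ^+ 2 = 2 * B ^+ 2 by apply/eqP; rewrite -subr_eq0 -/n n0.
  have A0 : A = 0.
    by apply/eqP; move: n0; rewrite /n B0 expr0n mulr0 subr0 => /eqP; rewrite sqrf_eq0.
  move: N; rewrite A0 B0 mul0r addr0 => /eqP; rewrite mulf_eq0 conjc_eq0 (negbTE y0) //.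
move: n En n0 => n En n0.
have hz : Zw (z16 * n%:~R).
  have -> : z16 * n%:~R = - (x * (conjc y * (A%:~R - B%:~R * r))).
    by rewrite -En; apply/eqP; rewrite -addr_eq0 mulrA -mulrDl addrC e mul0r.
  apply: ZwN; apply: ZwM => //; apply: ZwM; first exact: Zw_conj.
  apply: ZwB; solve_Zw.
case: hz => p [p2 [p3 [p4 Ez]]].
case: cos_pi8 => co [si [Ez16 hco]].
move: Ez; rewrite zw4_coord Ez16 intr_CC => -[h _].
move: h; rewrite mulr0 subr0; move: (p2 - p4) => q h.
(* The real part gives [co * n = p + q / √2]; squaring, with the value of [2 * co ^+ 2], yields a
   relation between 1 and √2. *)
have hh : (2 * n ^+ 2 - 4 * p ^+ 2 - 2 * q ^+ 2)%:~R + (n ^+ 2 - 4 * p * q)%:~R * rt2 = 0 :> R.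
  have n2 := rt2_neq0; have e2 := rt2_sq.
  rewrite !(rmorphD, rmorphB, rmorphM, rmorphXn) /=.
  have : 4 * (co * n%:~R) ^+ 2 = 4 * (p%:~R + q%:~R / rt2) ^+ 2 by rewrite h.
  rewrite exprMn.
  have -> : 4 * (co ^+ 2 * n%:~R ^+ 2) = (2 * co ^+ 2) * 2 * n%:~R ^+ 2 by ring.
  rewrite hco => /eqP; rewrite -subr_eq0 => /eqP h4.
  rewrite -[RHS]h4; field: e2 => //.
case: (sqrt2_lin_indep _ _ hh) => h1 h2.
(* From [n^2 = 2p^2 + q^2 = 4pq]: the left side is [4 (2p^2 + q^2)^2 - 2 (4pq)^2], that is
   [4n^4 - 2n^4]. *)
have /sqrt2_irrational/eqP : ((2 * p) ^+ 2 - 2 * q ^+ 2) ^+ 2 = 2 * (n ^+ 2) ^+ 2.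
  have h1' : n ^+ 2 = 2 * p ^+ 2 + q ^+ 2 by lia.
  have h2' : n ^+ 2 = 4 * p * q by lia.
  have -> : 2 * (n ^+ 2) ^+ 2 = 4 * (n ^+ 2) ^+ 2 - 2 * (n ^+ 2) ^+ 2 by ring.
  by rewrite {1}h1' h2'; ring.
by rewrite sqrf_eq0 (negbTE n0).
Qed.

Lemma R8_z16_free x y : R8 x -> R8 y -> x + z16 * y = 0 -> x = 0 /\ y = 0.
Proof.
move=> [k hk] [l hl] e.
have y0 : y = 0.
  have l0 : lam ^+ (k + l) != 0 by rewrite expf_neq0 // lam_neq0.
  apply: (mulfI l0); rewrite mulr0.
  apply: (@z16_notin_frac (lam ^+ (k + l) * x)).
  - exact: R8_le (leq_addr _ _) hk.
  - exact: R8_le (leq_addl _ _) hl.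
  - by rewrite mulrCA -mulrDr e mulr0.
by split=> //; move: e; rewrite y0 mulr0 addr0.
Qed.

(** * Two-level matrices *)

Lemma sum_sq_eq1 (I : finType) (F : I -> int) :
  (forall i, 0 <= F i) -> \sum_i F i = 1 -> exists i, F i = 1 /\ forall j, j != i -> F j = 0.
Proof.
move=> F0 e.
have [i Fi] : exists i, F i != 0.
  apply: contrapT => h; move: e; rewrite big1 // => i _.
  by apply/eqP; apply: contrapT => /negP Fi; apply: h; exists i.
have Fi1 : 1 <= F i by have := F0 i; lia.
move: e; rewrite (bigD1 i) //= => e.
have s0 : 0 <= \sum_(j | j != i) F j by apply: sumr_ge0.
have [ei /eqP es] : F i = 1 /\ \sum_(j | j != i) F j = 0.
  by move: (\sum_(j | _) _) (F i) e s0 Fi1 => S f; lia.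
exists i; split=> // j ji; apply/eqP; move: es.
by rewrite psumr_eq0 // => /allP/(_ j (mem_index_enum _)) /implyP/(_ ji).
Qed.

Lemma sum4_sq_eq1 (a b c d : int) : a ^+ 2 + b ^+ 2 + c ^+ 2 + d ^+ 2 = 1 ->
  exists s, zw4 a b c d = w ^+ s.
Proof.
move=> e.
have h0 (x : int) : 0 <= x ^+ 2 by exact: sqr_ge0.
have h1 (x : int) : x ^+ 2 = 0 -> x = 0 by move/eqP; rewrite sqrf_eq0 => /eqP.
have h2 (x : int) : x ^+ 2 = 1 -> x = 1 \/ x = -1.
  by move/eqP; rewrite sqrf_eq1 => /orP[] /eqP ->; [left|right].
have := (h0 a, h0 b, h0 c, h0 d) => -[[[ha hb] hc] hd].
have : a ^+ 2 = 1 /\ b ^+ 2 = 0 /\ c ^+ 2 = 0 /\ d ^+ 2 = 0 \/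
       a ^+ 2 = 0 /\ b ^+ 2 = 1 /\ c ^+ 2 = 0 /\ d ^+ 2 = 0 \/
       a ^+ 2 = 0 /\ b ^+ 2 = 0 /\ c ^+ 2 = 1 /\ d ^+ 2 = 0 \/
       a ^+ 2 = 0 /\ b ^+ 2 = 0 /\ c ^+ 2 = 0 /\ d ^+ 2 = 1 by lia.
rewrite /zw4.
case=> [|[|[|]]] [e1 [e2 [e3 e4]]].
- case: (h2 _ e1) => ->; rewrite (h1 _ e2) (h1 _ e3) (h1 _ e4); [exists 0%N|exists 4%N];
    rewrite ?w4 !mul0r !addr0 //.
- case: (h2 _ e2) => ->; rewrite (h1 _ e1) (h1 _ e3) (h1 _ e4); [exists 1%N|exists 5%N];
    rewrite ?(exprD w 4 1) ?w4 !mul0r !addr0 add0r ?mulN1r ?mul1r ?expr1 //.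
- case: (h2 _ e3) => ->; rewrite (h1 _ e1) (h1 _ e2) (h1 _ e4); [exists 2%N|exists 6%N];
    rewrite ?(exprD w 4 2) ?w4 !mul0r !addr0 !add0r ?mulN1r ?mul1r //.
- case: (h2 _ e4) => ->; rewrite (h1 _ e1) (h1 _ e2) (h1 _ e3); [exists 3%N|exists 7%N];
    rewrite ?(exprD w 4 3) ?w4 !mul0r !addr0 !add0r ?mulN1r ?mul1r //.
Qed.

(** By [zw4_norm] the rational part of the norm is the sum of the squares of all coordinates of all
    entries. It equals 1, so exactly one coordinate is nonzero, and it is 1 or -1. *)
Lemma unit_Zw (I : finType) (v : I -> CC) : (forall i, Zw (v i)) ->
  \sum_i v i * conjc (v i) = 1 ->
  exists i s, v i = w ^+ s /\ forall j, j != i -> v j = 0.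
Proof.
move=> hv.
have /fin_all_exists[f hf] : forall i, exists p : int * int * int * int,
    v i = zw4 p.1.1.1 p.1.1.2 p.1.2 p.2.
  by move=> i; case: (hv i) => a [b [c [d ->]]]; exists (a, b, c, d).
pose A i := (f i).1.1.1 ^+ 2 + (f i).1.1.2 ^+ 2 + (f i).1.2 ^+ 2 + (f i).2 ^+ 2.
have A0 i : 0 <= A i by rewrite /A !addr_ge0 ?sqr_ge0.
pose B i := (f i).1.1.1 * (f i).1.1.2 + (f i).1.1.2 * (f i).1.2 + (f i).1.2 * (f i).2 - (f i).2 *
  (f i).1.1.1.
under eq_bigr => i _ do rewrite hf zw4_norm -/(A i) -/(B i).
have -> : \sum_i Complex ((A i)%:~R + (B i)%:~R * rt2) 0 =
    Complex ((\sum_i A i)%:~R + (\sum_i B i)%:~R * rt2) 0 :> CC.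
  rewrite !raddf_sum mulr_suml -big_split /=.
  by rewrite -[RHS]/(real_complex R _) rmorph_sum.
move=> [e]; have : (\sum_i A i - 1)%:~R + (\sum_i B i)%:~R * rt2 = 0 :> R.
  by rewrite rmorphB /= addrAC e subrr.
move/sqrt2_lin_indep => [/eqP + _]; rewrite subr_eq0 => /eqP /(sum_sq_eq1 _ _ A0)[i [Ai Aj]].
have [s hs] := sum4_sq_eq1 _ _ _ _ Ai.
exists i, s; split=> [|j /Aj]; first by rewrite hf.
rewrite /A hf => /eqP; rewrite !paddr_eq0 ?addr_ge0 ?sqr_ge0 // !sqrf_eq0.
by move=> /andP[/andP[/andP[/eqP-> /eqP->] /eqP->] /eqP->]; rewrite /zw4 !mul0r !addr0.
Qed.

Definition ctmx {m n} (M : 'M[CC]_(m, n)) : 'M_(n, m) := (map_mx (@conjc R) M)^T.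

Lemma ctmxE {m n} (M : 'M[CC]_(m, n)) i j : ctmx M i j = conjc (M j i).
Proof. by rewrite !mxE. Qed.

Lemma ctmxM {m n p} (M : 'M[CC]_(m, n)) (N : 'M_(n, p)) : ctmx (M *m N) = ctmx N *m ctmx M.
Proof. by rewrite /ctmx map_mxM trmx_mul. Qed.

Lemma ctmx1 n : ctmx (1%:M : 'M_n) = 1%:M.
Proof. by rewrite /ctmx map_mx1 trmx1. Qed.

Lemma unitary_ctmxl n (U : 'M[CC]_n) : unitary U -> ctmx U *m U = 1%:M.
Proof. exact: mulmx1C. Qed.

Lemma unitaryM n (U V : 'M[CC]_n) : unitary U -> unitary V -> unitary (U *m V).
Proof.
rewrite /unitary -!/(ctmx _) => hU hV.
by rewrite ctmxM mulmxA -(mulmxA U) hV mulmx1.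
Qed.

Section TwoLevel.
Context {n : nat}.
Implicit Types (i j l : 'I_n) (T : {set 'I_n}) (W : 'M[CC]_n).

Definition two_level i j (a b c d : CC) : 'M[CC]_n :=
  \matrix_(x, y) if x == i then a *+ (y == i) + b *+ (y == j)
    else if x == j then c *+ (y == i) + d *+ (y == j) else (x == y)%:R.

Lemma two_level_mul p i j a b c d (M : 'M_(n, p)) x y :
  (two_level i j a b c d *m M) x y =
    if x == i then a * M i y + b * M j y
    else if x == j then c * M i y + d * M j y else M x y.
Proof.
have pick (e : CC) l : \sum_k (e *+ (k == l)) * M k y = e * M l y.
  rewrite (bigD1 l) //= eqxx mulr1n big1 ?addr0 // => k /negbTE->.
  by rewrite mulr0n mul0r.
rewrite !mxE; under eq_bigr => k _ do rewrite mxE.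
case: ifP => _; [|case: ifP => _].
- by rewrite -!pick -big_split /=; apply: eq_bigr => k _; rewrite -mulrDl.
- by rewrite -!pick -big_split /=; apply: eq_bigr => k _; rewrite -mulrDl.
- by rewrite -[RHS]mul1r -pick; apply: eq_bigr => k _; rewrite eq_sym.
Qed.

Lemma eq_mx_act m (A B : 'M[CC]_(m, n)) :
  (forall v : 'cV_n, A *m v = B *m v) -> A = B.
Proof.
move=> h; apply/matrixP => x y.
by have := congr1 (fun M : 'cV_m => M x 0) (h (delta_mx y 0)); rewrite -!colE !mxE.
Qed.

(** The exponent [7 * s + 4] encodes [- w^-s] in natural numbers. *)
Definition mixer s i j : 'M[CC]_n :=
  two_level i j hf (hf * w ^+ s) (hf * w ^+ (7 * s + 4)) hf.

Lemma mixer_act s i j p (M : 'M_(n, p)) x y : (mixer s i j *m M) x y =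
    if x == i then hf * M i y + hf * w ^+ s * M j y
    else if x == j then hf * w ^+ (7 * s + 4) * M i y + hf * M j y else M x y.
Proof. exact: two_level_mul. Qed.

Lemma wX8 s : w ^+ (7 * s) * w ^+ s = 1.
Proof. by rewrite -exprD -mulSnr exprM w8 expr1n. Qed.

Lemma mixer_unitary s i j : i != j -> unitary (mixer s i j).
Proof.
move=> ij; have ji : (j == i) = false by rewrite eq_sym (negbTE ij).
have hw : conjc (w ^+ s) = w ^+ (7 * s).
  apply: (mulIf (expf_neq0 s w_neq0)).
  by rewrite conjcX conj_w wX8 -exprMn mulVf ?w_neq0 // expr1n.
have hw' : conjc (w ^+ (7 * s)) = w ^+ s by rewrite -hw conjcK.
have hw4 : w ^+ (7 * s + 4) = - w ^+ (7 * s) by rewrite exprD w4 mulrN1.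
have e := wX8 s; have e2 := hf2.
have e3 := hf_sq_sum.
rewrite /unitary -/(ctmx _); apply/matrixP => x y.
rewrite mixer_act !ctmxE !mxE /= ?(eqxx, ji, (negbTE ij)) !(mulr1n, mulr0n) !(addr0, add0r) hw4.
case: (eqVneq x i) => [->|xi]; last case: (eqVneq x j) => [->|xj].
- case: (eqVneq y i) => [_|yi]; last case: (eqVneq y j) => [yj|yj].
  + by rewrite conjcM conj_hf hw -e3 /=; ring: e.
  + by rewrite conjcM conj_hf conjcN hw' ?yj ?(negbTE ij) /=; ring.
  + by rewrite !conjc0 !mulr0 addr0.
- case: (eqVneq y i) => [yi|yi]; last case: (eqVneq y j) => [_|yj].
  + by rewrite conjcM conj_hf hw ?yi ?ji /=; ring.
  + by rewrite conjcM conj_hf conjcN hw' -e3 /=; ring: e.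
  + by rewrite !conjc0 !mulr0 addr0.
- rewrite !mulr0n !addr0; case: (eqVneq y i) => [yi|yi]; last case: (eqVneq y j) => [yj|yj].
  + by rewrite conjc0 yi (negbTE xi).
  + by rewrite conjc0 yj (negbTE xj).
  + by rewrite conjc_nat [y == x]eq_sym.
Qed.

Lemma R8_wX s : R8 (w ^+ s). Proof. exact/Zw_R8/Zw_wX. Qed.

Lemma R8_nat (k : nat) : R8 k%:R. Proof. exact/Zw_R8/Zw_nat. Qed.

Lemma R8_mulmx m p q (A : 'M[CC]_(m, p)) (B : 'M_(p, q)) :
  (forall x y, R8 (A x y)) -> (forall x y, R8 (B x y)) -> forall x y, R8 ((A *m B) x y).
Proof. by move=> hA hB x y; rewrite !mxE; apply: R8_sum => k _; apply: R8M. Qed.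

Lemma R8_mixer s i j x y : R8 (mixer s i j x y).
Proof.
have h := R8_hf; have h0 := Zw_R8 _ Zw0.
rewrite -[mixer _ _ _]mulmx1 mixer_act !mxE.
by case: ifP => _; [|case: ifP => _]; do ?apply: R8D; do ?apply: R8M => //;
  first [exact: R8_wX | exact: R8_nat].
Qed.

(** [T] bounds the levels touched, so that columns already reduced to basis vectors outside [T] stay
    fixed. *)
Inductive mixer_gen T : 'M[CC]_n -> Prop :=
| mixer_gen1 : mixer_gen T 1%:M
| mixer_genM s i j W : i \in T -> j \in T -> i != j -> mixer_gen T W ->
    mixer_gen T (mixer s i j *m W).

Lemma mixer_gen_mul T V W : mixer_gen T V -> mixer_gen T W -> mixer_gen T (V *m W).
Proof.
move=> hV hW; elim: hV => [|s i j V' iT jT ij _ IH]; first by rewrite mul1mx.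
by rewrite -mulmxA; apply: mixer_genM.
Qed.

Lemma mixer_gen_mixer T s i j : i \in T -> j \in T -> i != j -> mixer_gen T (mixer s i j).
Proof. by move=> iT jT ij; rewrite -[mixer _ _ _]mulmx1; apply: mixer_genM => //; exact: mixer_gen1. Qed.

Lemma mixer_gen_sub T T' W : T' \subset T -> mixer_gen T' W -> mixer_gen T W.
Proof.
move=> /subsetP sT; elim=> [|s i j V' iT jT ij _ IH]; first exact: mixer_gen1.
by apply: mixer_genM => //; apply: sT.
Qed.

Lemma mixer_gen_unitary T W : mixer_gen T W -> unitary W.
Proof.
elim=> [|s i j V iT jT ij _ IH]; last exact: unitaryM (mixer_unitary _ _ _ ij) IH.
by rewrite /unitary -/(ctmx _) ctmx1 mulmx1.
Qed.

Lemma R8_mixer_gen T W : mixer_gen T W -> forall x y, R8 (W x y).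
Proof.
elim=> [|s i j V iT jT ij _ IH]; first by move=> x y; rewrite mxE; exact: R8_nat.
apply: R8_mulmx => //; exact: R8_mixer.
Qed.

Lemma mixer_gen_outside T W p (M : 'M_(n, p)) x y : mixer_gen T W -> x \notin T ->
  (W *m M) x y = M x y.
Proof.
move=> hW xT; elim: hW => [|s i j V iT jT ij _ IH]; first by rewrite mul1mx.
rewrite -mulmxA mixer_act.
by do 2!(case: eqP => [xE|_]; first by rewrite xE ?iT ?jT in xT).
Qed.

Lemma mixer_gen_fix T W (v : 'cV_n) : mixer_gen T W -> (forall x, x \in T -> v x 0 = 0) ->
  W *m v = v.
Proof.
move=> hW v0; elim: hW => [|s i j V iT jT ij _ IH]; first by rewrite mul1mx.
rewrite -mulmxA IH; apply/matrixP => x y; rewrite ord1 mixer_act.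
case: eqP => [->|_]; first by rewrite !v0 // !mulr0 addr0.
by case: eqP => [->|_] //; rewrite !v0 // !mulr0 addr0.
Qed.
End TwoLevel.

(** * Reduction of unitaries over R8 *)

Definition lam_dvd (x : CC) := exists y, Zw y /\ x = lam * y.

Lemma lam_dvd0 : lam_dvd 0.
Proof. by exists 0; split; [exact: Zw0|rewrite mulr0]. Qed.

Lemma lam_dvdD x y : lam_dvd x -> lam_dvd y -> lam_dvd (x + y).
Proof. by move=> [a [ha ->]] [b [hb ->]]; exists (a + b); split; [exact: ZwD|rewrite mulrDr]. Qed.

Lemma lam_dvdM x y : Zw x -> lam_dvd y -> lam_dvd (x * y).
Proof. by move=> hx [b [hb ->]]; exists (x * b); split; [exact: ZwM|rewrite mulrCA]. Qed.

Lemma lam_ndvd x : Zw x -> ~ lam_dvd x -> exists y, Zw y /\ x = 1 + lam * y.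
Proof.
move=> /Zw_mod_lam[[] [y [hy ->]]] h; first by exists y.
by case: h; exists y; rewrite add0r.
Qed.

Lemma lam_dvd_conj x : lam_dvd x -> lam_dvd (conjc x).
Proof.
move=> [y [hy ->]]; rewrite conjcM conj_lam mulrAC; apply: lam_dvdM.
  by apply: ZwM; [exact: Zw_wX|exact: Zw_conj].
by exists 1; rewrite mulr1; split=> //; exact: Zw1.
Qed.

Lemma lam_dvd_mul_lam y : Zw y -> lam_dvd (lam * y).
Proof. by exists y. Qed.

(** Write [a], [b] for the two entries. The shift by 4 turns the first row into
    [hf * (a - w ^+ s * b)], which is [hf * lam ^+ 3 * z], and [hf * lam ^+ 2] is integral. The
    second row is [hf * (w^-s * a + b)]; it differs from [2 * hf * b] by a term of the same kind,
    and [2 * hf], that is √2, is divisible by [lam]. *)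
Lemma mixer_lam_dvd s x y z : Zw x -> Zw y -> Zw z ->
  1 + lam * x = w ^+ s * (1 + lam * y) + lam ^+ 3 * z ->
  lam_dvd (hf * (1 + lam * x) + hf * w ^+ (s + 4) * (1 + lam * y)) /\
  lam_dvd (hf * w ^+ (7 * (s + 4) + 4) * (1 + lam * x) + hf * (1 + lam * y)).
Proof.
move=> hx hy hz e.
have hu : Zw (w - w ^+ 2 - 1) by do !apply: ZwB; solve_Zw.
split.
- exists ((w - w ^+ 2 - 1) * z); split; first exact: ZwM.
  by rewrite e -lam_sq exprD w4; ring.
- exists (w * (1 + w) * (1 + lam * y) + (w - w ^+ 2 - 1) * w ^+ (7 * s) * z); split.
    have hl := Zw_lam; apply: ZwD; first by solve_Zw.
    by apply: ZwM => //; apply: ZwM => //; exact: Zw_wX.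
  have -> : w ^+ (7 * (s + 4) + 4) = w ^+ (7 * s).
    by rewrite mulnDr -addnA exprD (exprM w 8 4) w8 expr1n mulr1.
  have e2 : hf * 2 = w * (1 + w) * lam by rewrite mulrC -hf_w /lam; ring.
  rewrite e -lam_sq; have e3 := wX8 s.
  transitivity (w ^+ (7 * s) * w ^+ s * hf * (1 + lam * y) + hf * (1 + lam * y) + hf * lam ^+ 3 * z
    * w ^+ (7 * s)); first by ring.
  rewrite e3; transitivity (hf * 2 * (1 + lam * y) + hf * lam ^+ 3 * z * w ^+ (7 * s)); first by ring.
  by rewrite e2; ring.
Qed.

Section ColumnReduction.
Context {n : nat}.
Implicit Types (T : {set 'I_n}) (v : 'cV[CC]_n).

Lemma ctmx_dot v : (ctmx v *m v) 0 0 = \sum_i v i 0 * conjc (v i 0).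
Proof. by rewrite mxE; apply: eq_bigr => i _; rewrite ctmxE mulrC. Qed.

Lemma dvd_sum (I : finType) (P : pred I) (F : I -> CC) :
  (forall i, P i -> lam_dvd (F i)) -> lam_dvd (\sum_(i | P i) F i).
Proof. by move=> h; elim/big_ind: _ => //; [exact: lam_dvd0|exact: lam_dvdD]. Qed.

Definition odd_entries v : {set 'I_n} := [set i | ~~ `[< lam_dvd (v i 0) >]].

Lemma odd_entriesP v i : reflect (~ lam_dvd (v i 0)) (i \in odd_entries v).
Proof. by rewrite inE; apply: (iffP idP) => /asboolPn. Qed.

Lemma odd_entriesPn v i : i \notin odd_entries v -> lam_dvd (v i 0).
Proof. by rewrite inE negbK => /asboolP. Qed.

(** A single entry prime to [lam] would make the norm congruent to 1, since conjugation preserves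
    divisibility by [lam]. *)
Lemma odd_entries_card v : (forall i, Zw (v i 0)) ->
  lam_dvd (\sum_i v i 0 * conjc (v i 0)) -> #|odd_entries v| != 1%N.
Proof.
move=> hv hs; apply/negP => /cards1P[i ei].
have hi : i \in odd_entries v by rewrite ei set11.
have hj j : j != i -> lam_dvd (v j 0).
  by move=> ji; apply: odd_entriesPn; rewrite ei inE.
have [y [hy ey]] := lam_ndvd _ (hv i) (odd_entriesP _ _ hi).
move: hs; rewrite (bigD1 i) //= => hs.
have hr : lam_dvd (\sum_(j | j != i) v j 0 * conjc (v j 0)).
  by apply: dvd_sum => j /hj h; rewrite mulrC; apply: lam_dvdM => //; exact: Zw_conj.
have : lam_dvd 1.
  have -> : (1 : CC) = (v i 0 * conjc (v i 0) + \sum_(j | j != i) v j 0 * conjc (v j 0))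
     + (- 1) * (\sum_(j | j != i) v j 0 * conjc (v j 0) + lam * y
                + (1 + lam * y) * conjc (lam * y)).
    by rewrite ey conjcD rmorph1; ring.
  apply: lam_dvdD => //; apply: lam_dvdM; first exact: (Zw_int (-1)).
  apply: lam_dvdD; first apply: lam_dvdD => //; first exact: lam_dvd_mul_lam.
  apply: lam_dvdM; last exact/lam_dvd_conj/lam_dvd_mul_lam.
  by rewrite -ey.
by move=> [z [hz ez]]; exact: (lam_nunit z).
Qed.

Lemma ctmx_mixer_gen T W v : mixer_gen T W -> ctmx (W *m v) *m (W *m v) = ctmx v *m v.
Proof.
move=> /mixer_gen_unitary/unitary_ctmxl h.
by rewrite ctmxM -mulmxA (mulmxA (ctmx W)) h mul1mx.
Qed.

(** Induction on the number of entries prime to [lam]. It is never 1, so such entries can be paired;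
    a mixer makes a pair divisible and keeps the norm, hence the hypothesis. *)
Lemma reduce_odd T v : (forall i, Zw (v i 0)) -> (forall i, i \notin T -> v i 0 = 0) ->
  lam_dvd ((ctmx v *m v) 0 0) ->
  exists W, mixer_gen T W /\ forall i, lam_dvd ((W *m v) i 0).
Proof.
have [m] := ubnP #|odd_entries v|; elim: m v => // m IH v cm hv hT hs.
have [o0|o0] := eqVneq (odd_entries v) set0.
  exists 1%:M; split=> [|i]; first exact: mixer_gen1.
  by rewrite mul1mx; apply: odd_entriesPn; rewrite o0 inE.
have /set0Pn[i oi] := o0.
have : #|odd_entries v :\ i| != 0%N.
  have := odd_entries_card v hv; rewrite -ctmx_dot => /(_ hs).
  by rewrite (cardsD1 i (odd_entries v)) oi.
rewrite cards_eq0 => /set0Pn[j]; rewrite in_setD1 => /andP[ji oj].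
have inT x : x \in odd_entries v -> x \in T.
  by move=> /odd_entriesP h; apply: contrapT => /negP /hT e; apply: h; rewrite e; exact: lam_dvd0.
have [x [hx ex]] := lam_ndvd _ (hv i) (odd_entriesP _ _ oi).
have [y [hy ey]] := lam_ndvd _ (hv j) (odd_entriesP _ _ oj).
have [s [z [hz e]]] := odd_pair _ _ hx hy.
have [hi hj] := mixer_lam_dvd _ _ _ _ hx hy hz e.
have hU : mixer_gen T (mixer (s + 4) i j).
  by apply: mixer_gen_mixer; rewrite ?inT // eq_sym.
set v' := mixer (s + 4) i j *m v.
have v'i : lam_dvd (v' i 0) by rewrite /v' mixer_act eqxx ex ey.
have v'j : lam_dvd (v' j 0) by rewrite /v' mixer_act (negbTE ji) eqxx ex ey.
have v'k k : k != i -> k != j -> v' k 0 = v k 0.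
  by move=> ki kj; rewrite /v' mixer_act (negbTE ki) (negbTE kj).
case: (IH v').
- rewrite -ltnS; apply: leq_trans cm; rewrite ltnS; apply: proper_card.
  apply/properP; split; last by exists i => //; apply/negP => /odd_entriesP.
  apply/subsetP => k /odd_entriesP h; apply/odd_entriesP.
  by rewrite -v'k //; apply/eqP => ek; apply: h; rewrite ek.
- move=> k; have [->|ki] := eqVneq k i; first by case: v'i => u [hu ->]; apply: ZwM => //; exact: Zw_lam.
  have [->|kj] := eqVneq k j; last by rewrite v'k.
  by case: v'j => u [hu ->]; apply: ZwM => //; exact: Zw_lam.
- by move=> k kT; rewrite /v' (mixer_gen_outside _ _ _ _ _ _ hU) // hT.
- by rewrite (ctmx_mixer_gen _ _ _ hU).
move=> W [hW hk]; exists (W *m mixer (s + 4) i j); split; first exact: mixer_gen_mul.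
by move=> k; rewrite -mulmxA.
Qed.

(** Induction on a common denominator exponent [k]: the scaled vector has norm divisible by [lam],
    so [reduce_odd] lowers [k] by one; at [k = 0] the column is integral and [unit_Zw] applies. *)
Lemma reduce_column T v : (forall i, R8 (v i 0)) -> (forall i, i \notin T -> v i 0 = 0) ->
  ctmx v *m v = 1%:M ->
  exists W i s, [/\ mixer_gen T W, i \in T & W *m v = w ^+ s *: delta_mx i 0].
Proof.
move=> hv hT hn.
have [k hk] : exists k, forall i, Zw (lam ^+ k * v i 0).
  have /fin_all_exists[f hf] := hv.
  exists (\max_i f i) => i; exact: R8_le (leq_bigmax i) (hf i).
clear hv; elim: k v hk hT hn => [|k IH] v hk hT hn.
  have [||i [s [ei ej]]] := unit_Zw _ (fun i => v i 0).
  - by move=> i; have := hk i; rewrite mul1r.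
  - by rewrite -ctmx_dot hn mxE.
  exists 1%:M, i, s; split; first exact: mixer_gen1.
    apply: contrapT => /negP /hT; rewrite ei => /eqP.
    by rewrite expf_eq0 (negbTE w_neq0) andbF.
  rewrite mul1mx; apply/matrixP => j y; rewrite ord1 !mxE /=.
  have [->|ji] := eqVneq j i; first by rewrite ei mulr1.
  by rewrite ej // mulr0.
have [||| W [hW hd]] := reduce_odd T (lam ^+ k.+1 *: v).
- by move=> i; rewrite mxE.
- by move=> i /hT h; rewrite mxE h mulr0.
- rewrite ctmx_dot; under eq_bigr => i _ do rewrite mxE conjcM mulrACA.
  rewrite -mulr_sumr -ctmx_dot hn mxE mulr1 exprS -mulrA.
  apply: lam_dvd_mul_lam; apply: ZwM; first exact: ZwX Zw_lam.
  by apply: Zw_conj; rewrite -exprS; exact: ZwX Zw_lam.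
have [|||W' [i [s [hW' iT e]]]] := IH (W *m v).
- move=> i; have [y [hy ey]] := hd i.
  suff -> : lam ^+ k * (W *m v) i 0 = y by [].
  apply: (mulfI lam_neq0); rewrite -ey mulrA -exprS.
  by rewrite -scalemxAr [in RHS]mxE.
- by move=> i iT; rewrite (mixer_gen_outside _ _ _ _ _ _ hW) // hT.
- by rewrite (ctmx_mixer_gen _ _ _ hW).
exists (W' *m W), i, s; split=> //; first exact: mixer_gen_mul.
by rewrite -mulmxA.
Qed.

(** On the two levels the mixer is [(1 + J) / √2] with [J] its normalised off-diagonal part and
    [J^2 = -1], so its square is [J]. *)
Lemma mixer_sq s i j p (M : 'M[CC]_(n, p)) x y : i != j ->
  (mixer s i j *m (mixer s i j *m M)) x y =
    if x == i then w ^+ s * M j y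
    else if x == j then w ^+ (7 * s + 4) * M i y else M x y.
Proof.
move=> ij; have ji : (j == i) = false by rewrite eq_sym (negbTE ij).
have e3 := hf_sq_sum.
have e := wX8 s.
have hw4 : w ^+ (7 * s + 4) = - w ^+ (7 * s) by rewrite exprD w4 mulrN1.
rewrite !mixer_act !eqxx ji hw4.
case: ifP => xi; [|case: ifP => xj]; last by rewrite xi xj.
- transitivity (hf * hf * (M i y * (1 - w ^+ (7 * s) * w ^+ s)) + (hf * hf + hf * hf) * w ^+ s * M
    j y); first by ring.
  by rewrite e e3 subrr mulr0 mulr0 add0r mul1r.
- transitivity (hf * hf * (M j y * (1 - w ^+ (7 * s) * w ^+ s)) - (hf * hf + hf * hf) * w ^+ (7 *
    s) * M i y); first by ring.
  by rewrite e e3 subrr mulr0 mulr0 add0r mul1r mulNr.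
Qed.

Lemma swap_basis T i j s c : i \in T -> j \in T -> i != j ->
  exists W, mixer_gen T W /\ W *m (c *: delta_mx i 0 : 'cV_n) = (c * w ^+ s) *: delta_mx j 0.
Proof.
move=> iT jT ij; have ji : (j == i) = false by rewrite eq_sym (negbTE ij).
exists (mixer s j i *m mixer s j i); split.
  by apply: mixer_gen_mul; apply: mixer_gen_mixer; rewrite // eq_sym.
apply/matrixP => x y; rewrite -mulmxA mixer_sq ?ji // ord1 !mxE !eqxx ji !andbT /=.
case: ifP => _; [|case: ifP => h] => //.
- by rewrite !mulr1 mulrC.
- by rewrite !mulr0.
- by rewrite h !mulr0.
Qed.

(** A phase on [l] itself is removed by a detour through [j], whose two swaps carry different
    phases. This needs a second free level, which the last column no longer has. *)
Lemma column_to_basis T l j v : l \in T -> j \in T -> l != j ->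
  (forall i, R8 (v i 0)) -> (forall i, i \notin T -> v i 0 = 0) ->
  ctmx v *m v = 1%:M -> exists W, mixer_gen T W /\ W *m v = delta_mx l 0.
Proof.
move=> lT jT lj hv hT hn; have [W [i [s [hW iT e]]]] := reduce_column T v hv hT hn.
have move_to k t : k \in T -> k != l ->
    exists W', mixer_gen T W' /\ W' *m (w ^+ t *: delta_mx k 0) = delta_mx l 0 :> 'cV_n.
  move=> kT kl; have [W' [hW' e']] := swap_basis T k l (7 * t)%N (w ^+ t) kT lT kl.
  by exists W'; split=> //; rewrite e' mulrC wX8 scale1r.
have [il|il] := eqVneq i l; last first.
  have [W' [hW' e']] := move_to i s iT il.
  by exists (W' *m W); split; [exact: mixer_gen_mul|rewrite -mulmxA e].
subst i; have [W1 [hW1 e1]] := swap_basis T l j 0%N (w ^+ s) lT jT lj.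
have [|W2 [hW2 e2]] := move_to j s jT; first by rewrite eq_sym.
exists (W2 *m (W1 *m W)); split; first by do !apply: mixer_gen_mul.
by rewrite -!mulmxA e e1 mulr1.
Qed.

Definition one_level l (c : CC) : 'M[CC]_n :=
  \matrix_(x, y) ((x == y)%:R * (if x == l then c else 1)).

Lemma one_level_act l c p (M : 'M_(n, p)) x y :
  (one_level l c *m M) x y = (if x == l then c else 1) * M x y.
Proof.
rewrite mxE (bigD1 x) //= big1 ?addr0; first by rewrite mxE eqxx mul1r.
by move=> k kx; rewrite mxE eq_sym (negbTE kx) !mul0r.
Qed.

Lemma reduce_unitary T l (M : 'M[CC]_n) : l \in T -> unitary M ->
  (forall x y, R8 (M x y)) ->
  (forall j, j \notin T -> col j M = delta_mx j 0) ->
  exists W s, mixer_gen T W /\ W *m M = one_level l (w ^+ s).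
Proof.
have [m] := ubnP #|T|; elim: m T M => // m IH T M cm lT hU hR hT.
have hA := unitary_ctmxl _ _ hU.
(* Orthogonality to the basis columns outside [T]. *)
have colT i j : i \in T -> j \notin T -> M j i = 0.
  move=> iT jT; have := congr1 (fun A : 'M_n => A j i) hA.
  rewrite !mxE (bigD1 j) //= big1 => [|k kj]; last first.
    have := congr1 (fun A : 'cV_n => A k 0) (hT j jT).
    by rewrite ctmxE !mxE (negbTE kj) => ->; rewrite conjc0 mul0r.
  have := congr1 (fun A : 'cV_n => A j 0) (hT j jT).
  rewrite ctmxE !mxE !eqxx => ->; rewrite conjc1 mul1r addr0 => ->.
  by case: eqP jT => // ->; rewrite iT.
have colu i : ctmx (col i M) *m col i M = 1%:M.
  apply/matrixP => x y; rewrite !ord1 ctmx_dot mxE eqxx.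
  have := congr1 (fun A : 'M_n => A i i) hA; rewrite !mxE eqxx => <-.
  by apply: eq_bigr => k _; rewrite ctmxE !mxE mulrC.
have [T1|T2] : T = [set l] \/ exists i, i \in T /\ i != l.
  have [->|h] := eqVneq T [set l]; first by left.
  right; have /properP[_ [i iT il]] : [set l] \proper T by rewrite properEneq eq_sym h sub1set.
  by exists i; split=> //; move: il; rewrite inE.
(* On one level no mixer exists, so this only says that the remaining diagonal entry is a power of
   [w]. *)
- have [|||W [i [s [hW iT e]]]] := reduce_column T (col l M).
  + by move=> i; rewrite mxE.
  + by move=> i iT; rewrite mxE colT.
  + exact: colu.
  exists W, s; split=> //; apply/matrixP => x y.
  have il : i = l by move: iT; rewrite T1 inE => /eqP.
  have -> : (W *m M) x y = (W *m col y M) x 0 by rewrite colE mulmxA -colE [RHS]mxE.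
  have [->|yl] := eqVneq y l.
    by rewrite e il !mxE eqxx andbT; case: (x == l); rewrite ?mulr1 ?mul1r ?mulr0 ?mul0r.
  have yT : y \notin T by rewrite T1 inE.
  rewrite hT // (mixer_gen_fix _ _ _ hW) => [|k]; last first.
    by rewrite T1 inE => /eqP->; rewrite mxE eq_sym (negbTE yl).
  by rewrite !mxE eqxx andbT; case: eqP => [->|_]; rewrite ?(negbTE yl) ?mulr1 ?mul0r.
- case: T2 => i [iT il].
  have [||||||W [hW e]] := column_to_basis T i l (col i M) => //.
  + by move=> j; rewrite mxE.
  + by move=> j jT; rewrite mxE colT.
  have hsub : T :\ i \subset T by exact: subsetDl.
  have [|||||W' [s [hW' e']]] := IH (T :\ i) (W *m M).
  + by move: cm; rewrite (cardsD1 i T) iT.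
  + by rewrite in_setD1 eq_sym il.
  + exact: unitaryM (mixer_gen_unitary _ _ hW) hU.
  + exact: R8_mulmx (R8_mixer_gen _ _ hW) hR.
  + move=> j; rewrite in_setD1 negb_and negbK => /orP[/eqP ->|jT].
      by rewrite colE -mulmxA -colE.
    rewrite colE -mulmxA -colE hT //; apply: (mixer_gen_fix _ _ _ hW) => x xT.
    by rewrite mxE; case: eqP xT jT => // -> ->.
  exists (W' *m W), s; split; last by rewrite -mulmxA.
  by apply: mixer_gen_mul hW; exact: mixer_gen_sub hsub hW'.
Qed.
End ColumnReduction.

(** * Circuits acting on bit strings *)

Lemma bit_ext k x y : (x < 2 ^ k)%N -> (y < 2 ^ k)%N ->
  (forall j, (j < k)%N -> bit j x = bit j y) -> x = y.
Proof.
elim: k x y => [|k IH] x y; first by rewrite expn0 !ltnS !leqn0 => /eqP-> /eqP->.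
move=> hx hy h; rewrite -(odd_double_half x) -(odd_double_half y).
have -> : odd x = odd y by have := h 0%N isT; rewrite /bit expn0 !divn1.
congr (_ + _.*2)%N; apply: IH.
- by rewrite -divn2 ltn_divLR // -expnSr.
- by rewrite -divn2 ltn_divLR // -expnSr.
by move=> j jk; have := h j.+1 jk; rewrite /bit expnS !divnMA !divn2.
Qed.

Section Circuits.
Context {k : nat}.
Implicit Types (q t c i j : 'I_k) (x y : 'I_(2 ^ k)) (f g : 'I_(2 ^ k) -> bool).

Lemma bit_inj x y : (forall j, bit j x = bit j y) -> x = y.
Proof. by move=> h; apply/val_inj; apply: (bit_ext k); rewrite ?ltn_ord // => j jk;
  exact: (h (Ordinal jk)). Qed.

(** By counting: the bit map is injective between sets of size [2 ^ k]. *)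
Lemma of_bits_subproof (b : {ffun 'I_k -> bool}) : exists x : 'I_(2 ^ k), [forall j : 'I_k, bit j x
  == b j].
Proof.
pose F x := [ffun j : 'I_k => bit j x].
have Finj : injective F.
  by move=> x y /ffunP e; apply: bit_inj => j; have := e j; rewrite !ffunE.
have : b \in codom F.
  apply: inj_card_onto => //.
  by rewrite card_ffun !card_ord card_bool.
by move=> /codomP[x ->]; exists x; apply/forallP => j; rewrite ffunE.
Qed.

Definition of_bits (b : {ffun 'I_k -> bool}) : 'I_(2 ^ k) := xchoose (of_bits_subproof b).

Lemma bit_of_bits b j : bit j (of_bits b) = b j.
Proof. by have /forallP/(_ j)/eqP := xchooseP (of_bits_subproof b). Qed.

Definition flip q x : 'I_(2 ^ k) := of_bits [ffun j : 'I_k => bit j x (+) (j == q)].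

Lemma bit_flip q x j : bit j (flip q x) = bit j x (+) (j == q).
Proof. by rewrite bit_of_bits ffunE. Qed.

Lemma flipK q : involutive (flip q).
Proof. by move=> x; apply: bit_inj => j; rewrite !bit_flip addbK. Qed.

Lemma flip_neq q x : (flip q x == x) = false.
Proof.
by apply/negP => /eqP/(congr1 (fun z : 'I_(2 ^ k) => bit q z)); rewrite bit_flip eqxx addbT; case: bit.
Qed.

Lemma flip_eqP q x y :
  reflect (y = x \/ y = flip q x) [forall j, (j != q) ==> (bit j x == bit j y)].
Proof.
apply: (iffP forallP) => [h|[->|->] j].
- case: (boolP (bit q x == bit q y)) => [/eqP e|ne]; [left|right];
    apply: bit_inj => j; rewrite ?bit_flip; have := h j;
    case: eqP => [->|_] /=; rewrite ?addbF; try by move/eqP->.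
  + by rewrite e.
  + by move: ne; case: bit; case: bit.
- by rewrite eqxx implybT.
- by rewrite bit_flip; case: (j == q) => //=; rewrite addbF.
Qed.

(** Induction on the Hamming distance to [x0]. *)
Lemma hypercube_ind (P : 'I_(2 ^ k) -> Prop) x0 :
  P x0 -> (forall q x, P x -> P (flip q x)) -> forall x, P x.
Proof.
move=> P0 Pflip x.
have [m] := ubnP #|[set j : 'I_k | bit j x != bit j x0]|.
elim: m x => // m IH x cm.
have [e|/set0Pn[q hq]] := eqVneq [set j : 'I_k | bit j x != bit j x0] set0.
  suff -> : x = x0 by [].
  apply: bit_inj => j; apply/eqP; apply/negPn/negP => h.
  by have : j \in set0 by [rewrite -e inE]; rewrite inE.
rewrite -[x](flipK q); apply/Pflip/IH; rewrite -ltnS; apply: leq_trans cm.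
rewrite ltnS; apply: proper_card; apply/properP; move: (hq); rewrite inE => hq'; split.
  apply/subsetP => j; rewrite !inE bit_flip; case: (j =P q) => [->|_]; last by rewrite addbF.
  by move=> _.
by exists q => //; rewrite inE bit_flip eqxx addbT negbK; move: hq'; case: bit; case: bit.
Qed.

Definition circ (M : 'M[CC]_(2 ^ k)) := exists cir : circuit k, circuit_mx 16 cir = M.

Lemma circuit_mx_cat (c1 c2 : circuit k) :
  circuit_mx 16 (c1 ++ c2) = circuit_mx 16 c2 *m circuit_mx 16 c1.
Proof. by elim: c1 => [|g c IH] /=; rewrite ?mulmx1 // IH mulmxA. Qed.

Lemma circ1 : circ 1%:M. Proof. by exists [::]. Qed.

Lemma circM M N : circ M -> circ N -> circ (M *m N).
Proof. by move=> [a <-] [b <-]; exists (b ++ a); rewrite circuit_mx_cat. Qed.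

Lemma circ_gate (g : gate k) : circ (gate_mx 16 g).
Proof. by exists [:: g]; rewrite /circuit_mx /= mul1mx. Qed.

(** Recording exponents modulo 16 turns products of diagonal circuits into sums, and their
    identities into arithmetic on bits. *)
Definition zdiag (e : 'I_(2 ^ k) -> nat) : 'M[CC]_(2 ^ k) :=
  \matrix_(x, y) ((x == y)%:R * z16 ^+ e x).

Lemma zdiag_act e p (M : 'M_(2 ^ k, p)) x z : (zdiag e *m M) x z = z16 ^+ e x * M x z.
Proof.
rewrite mxE (bigD1 x) //= big1 ?addr0; first by rewrite mxE eqxx mul1r.
by move=> j jx; rewrite mxE eq_sym (negbTE jx) !mul0r.
Qed.

Definition cflip t f : 'M[CC]_(2 ^ k) :=
  \matrix_(x, y) (y == if f x then flip t x else x)%:R.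

Lemma cflip_act t f p (M : 'M_(2 ^ k, p)) x z :
  (cflip t f *m M) x z = M (if f x then flip t x else x) z.
Proof.
rewrite mxE (bigD1 (if f x then flip t x else x)) //= big1 ?addr0.
  by rewrite mxE eqxx mul1r.
by move=> j jx; rewrite mxE (negbTE jx) mul0r.
Qed.

Definition hmx t : 'M[CC]_(2 ^ k) := gate_mx 16 (GH t).

Lemma embed1_act G t p (M : 'M_(2 ^ k, p)) x z : (embed1 G t *m M) x z =
  G (bit t x) (bit t x) * M x z + G (bit t x) (~~ bit t x) * M (flip t x) z.
Proof.
rewrite mxE (bigD1 x) //= (bigD1 (flip t x)) ?flip_neq //= big1 ?addr0.
  rewrite !mxE; case: flip_eqP => [_|[]]; last by left.
  by case: flip_eqP => [_|[]]; [rewrite bit_flip eqxx addbT|right].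
move=> j /andP[jx jf]; rewrite mxE; case: flip_eqP => [[]/eqP|_]; last by rewrite mul0r.
  by rewrite (negbTE jx).
by rewrite (negbTE jf).
Qed.

Lemma hmx_act t p (M : 'M_(2 ^ k, p)) x z :
  (hmx t *m M) x z = (if bit t x then - hf else hf) * M x z + hf * M (flip t x) z.
Proof. by rewrite embed1_act /H_gate; case: bit. Qed.

Lemma gate_T t : gate_mx 16 (GT t) = zdiag (fun x => bit t x).
Proof.
apply: eq_mx_act => v; apply/matrixP => x y.
rewrite [LHS]embed1_act zdiag_act /T_gate eqxx; case: bit => /=; by rewrite mul0r addr0.
Qed.

Lemma gate_S t : gate_mx 16 (GS t) = zdiag (fun x => 4 * bit t x)%N.
Proof.
apply: eq_mx_act => v; apply/matrixP => x y.
rewrite [LHS]embed1_act zdiag_act /S_gate eqxx; case: bit => /=; rewrite mul0r addr0 //.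
by rewrite muln1 (exprM _ 2 2) -wE w2.
Qed.

Lemma gate_CX c t (ct : c != t) : gate_mx 16 (GCX ct) = cflip t (bit c).
Proof.
have cte : (c == t) = false by exact/negbTE.
apply/matrixP => x y; rewrite !mxE; case: flip_eqP => [h|h] /=; last first.
  by case: eqP => // e; case: h; move: e; case: ifP => _; [right|left].
have -> : bit c y = bit c x by case: h => ->; rewrite ?bit_flip ?cte ?addbF.
case: h => ->; rewrite ?bit_flip ?eqxx; case: (bit c x); rewrite /= ?addbT ?addbF ?eqxx ?flip_neq.
- by rewrite [x == _]eq_sym flip_neq; case: bit.
- by [].
- by rewrite negbK eqxx.
- by case: bit.
Qed.
End Circuits.

(** * Synthesis of the mixers *)

Section Synthesis.
Context {k : nat}.
Implicit Types (q t c i j : 'I_k) (x y : 'I_(2 ^ k)) (f g : 'I_(2 ^ k) -> bool)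
  (e : 'I_(2 ^ k) -> nat) (A : {set 'I_k}) (M N W : 'M[CC]_(2 ^ k)) (T : {set 'I_(2 ^ k)}).

Lemma z16_8 : z16 ^+ 8 = -1. Proof. by rewrite (exprM _ 2 4) -wE w4. Qed.

Lemma zdiag_mul e e' : zdiag e *m zdiag e' = zdiag (fun x => e x + e' x)%N.
Proof. by apply: eq_mx_act => v; apply/matrixP => x z; rewrite -mulmxA !zdiag_act exprD mulrA. Qed.

Lemma eq_zdiag e e' : (forall x, (e x == e' x %[mod 16])%N) -> zdiag e = zdiag e'.
Proof.
move=> h; apply: eq_mx_act => v; apply/matrixP => x z; rewrite !zdiag_act.
by rewrite -(expr_mod _ z16_16) (eqP (h x)) expr_mod // z16_16.
Qed.

Lemma zdiag0 : zdiag (fun=> 0%N) = 1%:M :> 'M_(2 ^ k).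
Proof. by apply: eq_mx_act => v; apply/matrixP => x z; rewrite zdiag_act mul1mx mul1r. Qed.

Lemma circ_zdiagD e e' e'' : circ (zdiag e) -> circ (zdiag e') ->
  (forall x, (e'' x == e x + e' x %[mod 16])%N) -> circ (zdiag e'').
Proof. by move=> h h' E; rewrite (eq_zdiag _ _ E) -zdiag_mul; exact: circM. Qed.

Lemma circ_zdiagM n e : circ (zdiag e) -> circ (zdiag (fun x => n * e x)%N).
Proof.
move=> h; elim: n => [|n IH].
  rewrite (_ : (fun x => 0 * e x)%N = fun=> 0%N); last by apply: funext => x; rewrite mul0n.
  by rewrite zdiag0; exact: circ1.
by apply: circ_zdiagD h IH _ => x; rewrite mulSn.
Qed.

Lemma hmx_sq t : hmx t *m hmx t = 1%:M.
Proof.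
have e3 := hf_sq_sum.
apply: eq_mx_act => v; apply/matrixP => x z.
rewrite mul1mx -mulmxA !hmx_act flipK bit_flip eqxx addbT.
rewrite -[RHS]mul1r -e3; case: bit => /=; ring.
Qed.

Lemma cflip_sq t f : (forall x, f (flip t x) = f x) -> cflip t f *m cflip t f = 1%:M.
Proof.
move=> hf; apply: eq_mx_act => v; apply/matrixP => x z.
by rewrite mul1mx -mulmxA !cflip_act; case fx: (f x); rewrite ?hf fx ?flipK.
Qed.

Lemma circ_gate_inv (g : gate k) : exists M, circ M /\ M *m gate_mx 16 g = 1%:M.
Proof.
have diag_inv e : circ (zdiag e) -> exists M, circ M /\ M *m zdiag e = 1%:M.
  move=> h; exists (zdiag (fun x => 15 * e x)%N); split; first exact: circ_zdiagM.
  by rewrite zdiag_mul -zdiag0; apply: eq_zdiag => x; rewrite -mulSnr modnMr mod0n.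
case: g => [t|t|t|c t ct].
- exists (hmx t); split; [exact: (circ_gate (GH t))|exact: hmx_sq].
- by rewrite gate_S; apply: diag_inv; rewrite -gate_S; exact: circ_gate.
- by rewrite gate_T; apply: diag_inv; rewrite -gate_T; exact: circ_gate.
- exists (gate_mx 16 (GCX ct)); split; first exact: circ_gate.
  by rewrite gate_CX cflip_sq // => x; rewrite bit_flip (negbTE ct) addbF.
Qed.

Lemma circ_inv M : circ M -> exists M', [/\ circ M', M' *m M = 1%:M & M *m M' = 1%:M].
Proof.
move=> [cir <-]; elim: cir => [|g cir [M' [cM' e e']]].
  by exists 1%:M; rewrite mulmx1; split=> //; exact: circ1.
have [N [cN eN]] := circ_gate_inv g.
have h : (N *m M') *m (circuit_mx 16 cir *m gate_mx 16 g) = 1%:M.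
  by rewrite mulmxA -(mulmxA N) e mulmx1.
by exists (N *m M'); split=> //; [exact: circM|exact: mulmx1C].
Qed.

(** Conjugation by a permutation substitutes it into the exponent; as [f] ignores [t], the
    permutation is an involution. *)
Lemma circ_zdiag_cflip t f e : (forall x, f (flip t x) = f x) -> circ (cflip t f) ->
  circ (zdiag e) -> circ (zdiag (fun x => e (if f x then flip t x else x))).
Proof.
move=> hf cf ce.
suff -> : zdiag (fun x => e (if f x then flip t x else x)) = cflip t f *m zdiag e *m cflip t f.
  by do !apply: circM.
apply: eq_mx_act => v; apply/matrixP => x z.
rewrite -!mulmxA cflip_act !zdiag_act cflip_act; congr (_ * v _ _).
by case fx: (f x); rewrite ?hf fx ?flipK.
Qed.

Lemma circ_T t : circ (zdiag (fun x => bit t x)).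
Proof. by rewrite -gate_T; exact: circ_gate. Qed.

Lemma circ_hmx t : circ (hmx t). Proof. exact: circ_gate. Qed.

Lemma circ_CX c t : c != t -> circ (cflip t (bit c)).
Proof. by move=> ct; rewrite -(gate_CX c t ct); exact: circ_gate. Qed.

(** For bits, [2ab = a + b - (a xor b)]; the factor 15 is -1 modulo 16. *)
Lemma circ_CT c t : c != t -> circ (zdiag (fun x => 2 * (bit c x * bit t x))%N).
Proof.
move=> ct; have hinv x : bit c (flip t x) = bit c x by rewrite bit_flip (negbTE ct) addbF.
apply: (circ_zdiagD _ _ _ (circ_T c)).
  apply: circ_zdiagD (circ_T t) _ _ => [|x]; last exact: eqxx.
  exact: circ_zdiagM 15%N _ (circ_zdiag_cflip t (bit c) _ hinv (circ_CX c t ct) (circ_T t)).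
move=> x /=; have -> : bit t (if bit c x then flip t x else x : 'I_(2 ^ k)) = bit c x (+) bit t x.
  by case: ifP => h; rewrite ?bit_flip ?eqxx ?addbT.
by case: (bit c x); case: (bit t x).
Qed.

(** [H Z H = X], under the control [f]. *)
Lemma circ_cflip t f : (forall x, f (flip t x) = f x) ->
  circ (zdiag (fun x => 8 * (f x && bit t x))%N) -> circ (cflip t f).
Proof.
move=> hinv cf.
suff -> : cflip t f = hmx t *m zdiag (fun x => 8 * (f x && bit t x))%N *m hmx t.
  by do ?apply: circM => //; exact: circ_hmx.
have e3 := hf_sq_sum.
apply: eq_mx_act => v; apply/matrixP => x z.
rewrite -!mulmxA cflip_act !hmx_act !zdiag_act !hmx_act flipK hinv bit_flip eqxx addbT.
case: (f x); case: (bit t x);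
  rewrite /= ?muln0 ?muln1 ?z16_8 ?expr0 ?mul1r ?mulN1r -[LHS]mul1r -e3; ring.
Qed.

(** The commutator: where [f] and [bit i] hold, the exponent is [2 (1 - t) - 2t], that is 2 or
    -2. *)
Lemma circ_phase_pair t i f : i != t -> (forall x, f (flip t x) = f x) -> circ (cflip t f) ->
  circ (zdiag (fun x => if f x && bit i x then if bit t x then 14 else 2 else 0)%N).
Proof.
move=> it hinv cf; have c1 := circ_CT i t it.
apply: circ_zdiagD (circ_zdiag_cflip t f _ hinv cf c1) (circ_zdiagM 15%N _ c1) _ => x.
case: (f x) => /=; last by rewrite -mulSn modnMr.
by rewrite !bit_flip eqxx (negbTE it) addbF addbT; case: (bit i x); case: (bit t x).
Qed.

(** In exponents modulo 16, [4ij (1 - 2t) - 4ij = - 8ijt = 8ijt]. *)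
Lemma circ_CCZ i j t : i != t -> j != t -> i != j ->
  circ (zdiag (fun x => 8 * [&& bit i x, bit j x & bit t x])%N).
Proof.
move=> it jt ij; have hinv x : bit j (flip t x) = bit j x by rewrite bit_flip (negbTE jt) addbF.
have c1 := circ_phase_pair t i (bit j) it hinv (circ_CX j t jt).
apply: circ_zdiagD (circ_zdiagM 2%N _ c1) (circ_zdiagM 6%N _ (circ_CT i j ij)) _ => x.
by case: (bit i x); case: (bit j x); case: (bit t x).
Qed.

(** * Gates with many controls *)

Definition monomial A x := [forall j in A, bit j x].

Lemma monomial1 j x : monomial [set j] x = bit j x.
Proof.
apply/forall_inP/idP => [h|h i]; first by apply: h; rewrite set11.
by rewrite inE => /eqP->.
Qed.

Lemma monomialU1 j A x : monomial (j |: A) x = bit j x && monomial A x.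
Proof.
apply/forall_inP/andP => [h|[h /forall_inP hA] i].
  split; first by apply: h; rewrite setU11.
  by apply/forall_inP => i iA; apply: h; rewrite in_setU iA orbT.
by rewrite in_setU1 => /orP[/eqP->|/hA].
Qed.

Lemma monomial_flip t A x : t \notin A -> monomial A (flip t x) = monomial A x.
Proof.
move=> tA; apply/forall_inP/forall_inP => h i iA; have := h i iA; rewrite bit_flip;
  by case: (i =P t) => [e|_]; rewrite ?addbF // -e iA in tA *.
Qed.

(** A qubit [t] outside [A] is borrowed in any state: with [A] the union of [i], [j] and [B],
    toggling [t] by [ij] around a Z on [t] and [B] gives [8B ((t xor ij) - t)], equal to [8Bij]
    modulo 16. The Z used has one qubit fewer than [A]. *)
Lemma circ_CZ A : A != set0 -> A != setT -> circ (zdiag (fun x => 8 * monomial A x)%N).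
Proof.
have [m] := ubnP #|A|; elim: m A => // m IH A cm A0 AT.
have /set0Pn[i iA] := A0.
have [B0|/set0Pn[j]] := eqVneq (A :\ i) set0.
  have -> : A = [set i] by rewrite -(setD1K iA) B0 setU0.
  rewrite (_ : (fun x => _) = fun x => 8 * bit i x)%N; last by apply: funext => x; rewrite monomial1.
  exact: circ_zdiagM (circ_T i).
move=> jAi; have /andP[ji jA] : (j != i) && (j \in A) by rewrite -in_setD1.
have [t tA] : exists t, t \notin A.
  by apply/existsP; rewrite -negb_forall; apply: contra AT => /forallP h; apply/eqP/setP => x;
    rewrite h inE.
pose B := A :\ i :\ j.
have AE : A = i |: (j |: B) by rewrite /B setD1K // setD1K.
have it : i != t by apply: contraNneq tA => <-.
have jt : j != t by apply: contraNneq tA => <-.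
have tB : t \notin B by rewrite !in_setD1 (negbTE tA) !andbF.
pose f x := bit i x && bit j x.
have finv x : f (flip t x) = f x by rewrite /f !bit_flip (negbTE it) (negbTE jt) !addbF.
have cf : circ (cflip t f).
  apply: circ_cflip => //.
  rewrite (_ : (fun x => _) = fun x => 8 * [&& bit i x, bit j x & bit t x])%N.
    by apply: circ_CCZ => //; rewrite eq_sym.
  by apply: funext => x; rewrite /f andbA.
have cB : circ (zdiag (fun x => 8 * monomial (t |: B) x)%N).
  apply: IH.
  - rewrite -ltnS; apply: leq_trans cm.
    by rewrite cardsU1 tB (cardsD1 i A) iA (cardsD1 j (A :\ i)) jAi.
  - by apply/set0Pn; exists t; rewrite setU11.
  - by apply: contraTneq (in_setT i) => <-; rewrite in_setU1 (negbTE it) !in_setD1 eqxx /= andbF.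
apply: circ_zdiagD (circ_zdiag_cflip t f _ finv cf cB) (circ_zdiagM 15%N _ cB) _ => x.
rewrite AE !monomialU1 -/B /f; case: (bit i x) => /=; last by rewrite -mulSn modnMr.
case: (bit j x) => /=; last by rewrite -mulSn modnMr.
by rewrite bit_flip eqxx addbT monomial_flip //; case: (bit t x); case: (monomial B x).
Qed.

Definition ones : 'I_(2 ^ k) := of_bits [ffun=> true].

Lemma bit_ones j : bit j ones = true.
Proof. by rewrite bit_of_bits ffunE. Qed.

Lemma monomial_ones t x : monomial (~: [set t]) x = (x == ones) || (x == flip t ones).
Proof.
apply/forall_inP/orP => [h|h j].
  case: (boolP (bit t x)) => tx; [left|right]; apply/eqP/bit_inj => j;
    rewrite ?bit_flip !bit_ones; case: (j =P t) => [->|/eqP jt] //=.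
  - by rewrite h // !inE.
  - exact/negbTE.
  - by rewrite h // !inE.
rewrite !inE => jt; case: h => /eqP->; rewrite ?bit_flip bit_ones //.
Qed.

Definition zpair t x : nat :=
  if monomial (~: [set t]) x then if bit t x then 14 else 2 else 0.

(** [i] is used twice: idle, it is the qubit borrowed for the X on [t] controlled by all the others;
    in the commutator it controls the [T^2]. *)
Lemma circ_zpair t i : i != t -> circ (zdiag (zpair t)).
Proof.
move=> it; have it' : i \notin [set t] by rewrite inE.
have AE : ~: [set t] = i |: (~: [set t] :\ i) by rewrite setD1K // in_setC.
pose f := monomial (~: [set t] :\ i).
have finv x : f (flip t x) = f x by rewrite /f monomial_flip // !inE eqxx andbF.
have cf : circ (cflip t f).
  apply: circ_cflip => //.
  rewrite (_ : (fun x => _) = fun x => 8 * monomial (~: [set i]) x)%N.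
    apply: circ_CZ; first by apply/set0Pn; exists t; rewrite !inE eq_sym.
    by apply: contraTneq (in_setT i) => <-; rewrite !inE eqxx.
  apply: funext => x; rewrite /f.
  have -> : ~: [set i] = t |: (~: [set t] :\ i).
    by apply/setP => j; rewrite !inE; case: (j =P t) => [->|_] /=; rewrite ?andbT // eq_sym it.
  by rewrite monomialU1 andbC.
have := circ_phase_pair t i f it finv cf; congr (circ (zdiag _)).
by apply: funext => x; rewrite /zpair AE monomialU1 andbC.
Qed.

Lemma wX_mod8 a b : (a == b %[mod 8])%N -> w ^+ a = w ^+ b.
Proof. by move=> /eqP h; rewrite -(expr_mod _ w8) h expr_mod // w8. Qed.

Lemma mixer_mod8 a b x y : (a == b %[mod 8])%N -> mixer a x y = mixer b x y :> 'M_(2 ^ k).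
Proof.
move=> h; rewrite /mixer (wX_mod8 _ _ h) (wX_mod8 (7 * a + 4) (7 * b + 4)) //.
by rewrite eqn_modDr -modnMmr (eqP h) modnMmr.
Qed.

Lemma z16_even n : z16 ^+ (2 * n) = w ^+ n.
Proof. by rewrite exprM wE. Qed.

(* [H] conjugates [diag(w, w^-1)] to [(1 + i X) / sqrt 2], which is [mixer 2]; the other
   mixers are its conjugates by powers of [T]. *)
Lemma circ_mixer_ones t i s : i != t -> circ (mixer s (flip t ones) ones).
Proof.
move=> it; have cE := circ_zpair t i it.
have e3 := hf_sq_sum.
have e4 : w + w ^+ 7 = 2 * hf by rewrite (exprD w 4 3) w4 mulN1r hf_w.
have e5 : w - w ^+ 7 = 2 * hf * w ^+ 2 by rewrite -hf_w; ring: w4.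
have b0 : bit t (flip t ones) = false by rewrite bit_flip bit_ones eqxx.
have z2 : z16 ^+ 2 = w by rewrite wE.
have z14 : z16 ^+ 14 = w ^+ 7 by rewrite (z16_even 7).
have w18 : w ^+ (7 * 2 + 4) = w ^+ 2 by exact: wX_mod8.
have key : hmx t *m zdiag (zpair t) *m hmx t = mixer 2 (flip t ones) ones.
  apply: eq_mx_act => v; apply/matrixP => x z.
  rewrite mixer_act -!mulmxA !hmx_act !zdiag_act !hmx_act flipK bit_flip eqxx addbT.
  rewrite /zpair monomial_flip ?inE ?eqxx // bit_flip eqxx addbT w18.
  rewrite monomial_ones orbC.
  have [->|x0] := eqVneq x (flip t ones).
    rewrite b0 flipK /= z2 z14.
    transitivity (hf * hf * ((w + w ^+ 7) * v (flip t ones) z + (w - w ^+ 7) * v ones z)); first by ring.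
    by rewrite e4 e5; transitivity ((hf * hf + hf * hf) * (hf * v (flip t ones) z + hf * w ^+ 2 * v
      ones z)); [ring|rewrite e3 mul1r].
  have [->|x1] := eqVneq x ones.
    rewrite bit_ones /= z2 z14.
    transitivity (hf * hf * ((w + w ^+ 7) * v ones z + (w - w ^+ 7) * v (flip t ones) z)); first by ring.
    by rewrite e4 e5; transitivity ((hf * hf + hf * hf) * (hf * w ^+ 2 * v (flip t ones) z + hf * v
      ones z)); [ring|rewrite e3 mul1r].
  by rewrite -[RHS]mul1r -e3 /=; case: (bit t x) => /=; ring.
have c2 : circ (mixer 2 (flip t ones) ones).
  by rewrite -key; do ?apply: circM => //; exact: circ_hmx.
rewrite (mixer_mod8 s (2 + (s + 6))); last by rewrite addnCA modnDr.
move: (s + 6)%N => n.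
suff -> : mixer (2 + n) (flip t ones) ones =
    zdiag (fun x => 14 * n * bit t x)%N *m mixer 2 (flip t ones) ones *m zdiag (fun x => 2 * n *
      bit t x)%N.
  by do ?apply: circM => //; apply: circ_zdiagM; exact: circ_T.
apply: eq_mx_act => v; apply/matrixP => x z.
rewrite -!mulmxA zdiag_act !mixer_act !zdiag_act b0 bit_ones !muln0 !muln1.
rewrite -(mulnA 2 7) !z16_even mul1r w18.
have wn : w ^+ (7 * (2 + n) + 4) = w ^+ (7 * n) * w ^+ 2.
  by rewrite -exprD; apply: wX_mod8; apply/eqP; lia.
have e := wX8 n.
have [->|x0] := eqVneq x (flip t ones).
  by rewrite b0 muln0 !mul1r exprD; ring.
have [->|x1] := eqVneq x ones.
  by rewrite bit_ones !muln1 z16_even wn; ring: e.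
case: (bit t x); rewrite ?muln0 ?muln1 ?z16_even ?mul1r //.
by rewrite mulrA e mul1r.
Qed.

(** * Mixers on arbitrary pairs of levels *)

Definition mixable x y := forall s, circ (mixer s x y).

Lemma circ_X t : circ (cflip t xpredT).
Proof. by apply: circ_cflip => //=; apply: circ_zdiagM; exact: circ_T. Qed.

Lemma mixable_flip q x y : mixable x y -> mixable (flip q x) (flip q y).
Proof.
move=> h s.
suff -> : mixer s (flip q x) (flip q y) = cflip q xpredT *m mixer s x y *m cflip q xpredT.
  by do ?apply: circM => //; exact: circ_X.
apply: eq_mx_act => v; apply/matrixP => a z.
rewrite -!mulmxA cflip_act !mixer_act !cflip_act /= flipK.
by rewrite !(can2_eq (flipK q) (flipK q)).
Qed.

Lemma mixable_edge t i : i != t -> forall y, mixable (flip t y) y.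
Proof.
move=> it; apply: (@hypercube_ind _ _ ones); first by move=> s; exact: circ_mixer_ones it.
move=> q y h; have -> : flip t (flip q y) = flip q (flip t y); last exact: mixable_flip.
by apply: bit_inj => j; rewrite !bit_flip addbAC.
Qed.

(** The signed swap [mixer 0] squared carries level [u] to level [y], and [mixer 4] squared is its
    inverse. *)
Lemma mixable_trans x y u : x != y -> y != u -> x != u ->
  mixable x y -> mixable y u -> mixable x u.
Proof.
move=> xy yu xu hxy hyu s.
suff -> : mixer s x u = mixer 4 y u *m mixer 4 y u *m (mixer s x y *m (mixer 0 y u *m mixer 0 y u)).
  by do ?apply: circM.
apply: eq_mx_act => v; apply/matrixP => a z.
have ux : (u == x) = false by rewrite eq_sym (negbTE xu).
have uy : (u == y) = false by rewrite eq_sym (negbTE yu).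
have yx : (y == x) = false by rewrite eq_sym (negbTE xy).
rewrite -!mulmxA; set N := mixer 0 y u *m (mixer 0 y u *m v).
have eN b : N b z = if b == y then v u z else if b == u then - v y z else v b z.
  by rewrite /N mixer_sq // muln0 w4 expr0 mul1r mulN1r.
clearbody N; rewrite mixer_sq // !mixer_act !eN !eqxx ux uy yx (negbTE xy) (negbTE xu).
rewrite (wX_mod8 (7 * 4 + 4) 0) // w4 expr0 mul1r mulN1r.
have [->|ay] := eqVneq a y; first by rewrite yx (negbTE yu) opprK.
have [->|au] := eqVneq a u; first by rewrite ux.
by case: eqP.
Qed.

(** The hypercube is connected; two qubits are required because an edge mixer needs a qubit besides
    the flipped one. *)
Lemma mixable_all x y : (1 < k)%N -> x != y -> mixable x y.
Proof.
move=> k1.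
have other t : exists i, i != t.
  have : (0 < #|[set~ t]|)%N by rewrite cardsC1 card_ord -ltnS prednK // ltnW.
  by case/card_gt0P => i; rewrite !inE => h; exists i.
have edge q z : mixable (flip q z) z by have [i hi] := other q; exact: mixable_edge hi z.
suff h : forall y, y = x \/ mixable x y by case: (h y) => // ->; rewrite eqxx.
apply: (@hypercube_ind _ _ x); first by left.
move=> q z; have [e|n] := eqVneq (flip q z) x; first by left.
case=> [->|h]; right; first by rewrite -{1}[x](flipK q); exact: edge.
have [e|n'] := eqVneq z x; first by rewrite e -{1}[x](flipK q); exact: edge.
apply: (mixable_trans x z) => //; rewrite 1?eq_sym ?flip_neq //.
by rewrite -{1}[z](flipK q); exact: edge.
Qed.

Lemma circ_mixer_gen T W : (1 < k)%N -> mixer_gen T W -> circ W.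
Proof.
move=> k1; elim=> [|s i j V _ _ ij _ IH]; first exact: circ1.
by apply: circM => //; exact: mixable_all.
Qed.
End Synthesis.

(** * Representable matrices are unitary over R16 *)

Lemma in_Rn_sub n x y : in_Rn n x -> in_Rn n y -> in_Rn n (x - y).
Proof.
move=> hx hy S hS h z; have [_ hB _] := hS.
exact: hB (hx S hS h z) (hy S hS h z).
Qed.

Lemma in_RnM n x y : in_Rn n x -> in_Rn n y -> in_Rn n (x * y).
Proof.
move=> hx hy S hS h z; have [_ _ hM] := hS.
exact: hM (hx S hS h z) (hy S hS h z).
Qed.

Lemma in_Rn1 n : in_Rn n 1.
Proof. by move=> S []. Qed.

Lemma in_Rn0 n : in_Rn n 0.
Proof. by rewrite -(subrr 1); exact: in_Rn_sub (in_Rn1 n) (in_Rn1 n). Qed.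

Lemma in_RnN n x : in_Rn n x -> in_Rn n (- x).
Proof. by rewrite -sub0r; apply: in_Rn_sub; exact: in_Rn0. Qed.

Lemma in_RnD n x y : in_Rn n x -> in_Rn n y -> in_Rn n (x + y).
Proof. by move=> hx hy; rewrite -[y]opprK; apply: in_Rn_sub => //; exact: in_RnN. Qed.

Lemma in_RnX n x j : in_Rn n x -> in_Rn n (x ^+ j).
Proof. by move=> hx; elim: j => [|j IH]; [exact: in_Rn1|rewrite exprS; exact: in_RnM]. Qed.

Lemma in_Rn_half n : in_Rn n (1 / 2). Proof. by []. Qed.

Lemma in_Rn_zeta n : in_Rn n (zeta n). Proof. by []. Qed.

Lemma in_Rn_mulmx n m p q (A : 'M[CC]_(m, p)) (B : 'M_(p, q)) :
  (forall x y, in_Rn n (A x y)) -> (forall x y, in_Rn n (B x y)) ->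
  forall x y, in_Rn n ((A *m B) x y).
Proof.
move=> hA hB x y; rewrite mxE; elim/big_ind: _ => //; [exact: in_Rn0|exact: in_RnD|].
by move=> i _; exact: in_RnM.
Qed.

Lemma in_R16_hf : in_Rn 16 hf.
Proof.
have hw j : in_Rn 16 (w ^+ j) by rewrite wE; do 2!apply: in_RnX; exact: in_Rn_zeta.
rewrite hfE -[_^-1]mul1r; apply: in_RnM (in_Rn_half _); apply: in_Rn_sub => //.
by rewrite -[w]expr1.
Qed.

Lemma circ_R16 k (M : 'M[CC]_(2 ^ k)) : circ M -> forall x y, in_Rn 16 (M x y).
Proof.
have hb (b : bool) : in_Rn 16 b%:R by case: b; [exact: in_Rn1|exact: in_Rn0].
move=> [cir <-]; elim: cir => [|g c IH] /=; first by move=> x y; rewrite mxE.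
apply: in_Rn_mulmx => // x y; case: g => [t|t|t|a t ct].
- by rewrite mxE; case: ifP => _; [rewrite /H_gate; case: ifP => _; [apply: in_RnN|];
    exact: in_R16_hf|exact: in_Rn0].
- by rewrite gate_S mxE; apply: in_RnM => //; apply: in_RnX; exact: in_Rn_zeta.
- by rewrite gate_T mxE; apply: in_RnM => //; apply: in_RnX; exact: in_Rn_zeta.
- by rewrite gate_CX mxE.
Qed.

Lemma zdiag_unitary k (e : 'I_(2 ^ k) -> nat) : unitary (zdiag e).
Proof.
rewrite /unitary -/(ctmx _); apply/matrixP => x y.
rewrite zdiag_act ctmxE !mxE conjcM conjcX conj_z16 conjc_nat [y == x]eq_sym.
have [->|_] := eqVneq x y; last by rewrite mul0r mulr0.
by rewrite mul1r -exprMn mulfV ?z16_neq0 // expr1n.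
Qed.

Lemma circ_unitary k (M : 'M[CC]_(2 ^ k)) : circ M -> unitary M.
Proof.
move=> [cir <-]; elim: cir => [|g c IH] /=; first by rewrite /unitary -/(ctmx _) ctmx1 mulmx1.
apply: unitaryM IH _; case: g => [t|t|t|a t ct].
- rewrite /unitary -/(ctmx _); suff -> : ctmx (gate_mx 16 (GH t)) = gate_mx 16 (GH t) by exact: hmx_sq.
  have hr b d : conjc (H_gate b d) = H_gate d b.
    by rewrite /H_gate andbC; case: ifP => _; rewrite ?conjcN conj_hf.
  apply/matrixP => x y; rewrite ctmxE !mxE.
  rewrite [in RHS](_ : [forall _, _] = [forall j : 'I_k, (j != t) ==> (bit j y == bit j x)]).
    by case: ifP => _; rewrite ?hr ?conjc0.
  by apply: eq_forallb => j; rewrite [bit j x == _]eq_sym.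
- by rewrite gate_S; exact: zdiag_unitary.
- by rewrite gate_T; exact: zdiag_unitary.
- rewrite gate_CX; have hinv x : bit a (flip t x) = bit a x by rewrite bit_flip (negbTE ct) addbF.
  rewrite /unitary -/(ctmx _); suff -> : ctmx (cflip t (bit a)) = cflip t (bit a) by exact: cflip_sq.
  apply/matrixP => x y; rewrite ctmxE !mxE conjc_nat; congr ((nat_of_bool _)%:R).
  case: ifP => hy; case: ifP => hx //.
  + by rewrite eq_sym (can2_eq (flipK t) (flipK t)).
  + by apply/eqP/eqP => e; [move: hx; rewrite e hinv hy|move: hx; rewrite -e hy].
  + by apply/eqP/eqP => e; [move: hy; rewrite -e hx|move: hy; rewrite e hinv hx].
Qed.

Definition anc_mx (m a : nat) : 'M[CC]_(2 ^ (m + a), 2 ^ m) :=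
  \matrix_(x, u) ((x %% 2 ^ a == 0)%N && (hi_idx x == u))%:R.

Lemma tens_e0E m a v : tens_e0 a v = anc_mx m a *m v.
Proof.
apply/matrixP => x z; rewrite !mxE ord1 (bigD1 (hi_idx x)) //= big1 ?addr0.
  by rewrite mxE eqxx andbT; case: ifP; rewrite ?mul1r ?mul0r.
by move=> u; rewrite mxE eq_sym => /negbTE->; rewrite andbF mul0r.
Qed.

Lemma pack_subproof m a (u : 'I_(2 ^ m)) (r : 'I_(2 ^ a)) : (u * 2 ^ a + r < 2 ^ (m + a))%N.
Proof.
have h : (u.+1 * 2 ^ a <= 2 ^ (m + a))%N by rewrite expnD leq_mul2r ltn_ord orbT.
by apply: leq_trans h; rewrite mulSn addnC ltn_add2r.
Qed.

Definition pack m a (u : 'I_(2 ^ m)) (r : 'I_(2 ^ a)) : 'I_(2 ^ (m + a)) :=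
  Ordinal (pack_subproof m a u r).

Lemma hi_pack m a u r : hi_idx (pack m a u r) = u.
Proof. by apply: val_inj; rewrite /= divnMDl ?expn_gt0 // divn_small ?addn0. Qed.

Lemma anc_isometry m a : ctmx (anc_mx m a) *m anc_mx m a = 1%:M.
Proof.
have h0 : (0 < 2 ^ a)%N by rewrite expn_gt0.
apply/matrixP => u u'; rewrite mxE (bigD1 (pack m a u (Ordinal h0))) //= big1 => [|x].
  by rewrite ctmxE !mxE hi_pack /= addn0 modnMl !eqxx conjc1 mul1r addr0.
move=> hx; rewrite ctmxE !mxE; case: eqP => [e|]; last by rewrite conjc0 mul0r.
case: eqP => [e'|]; last by rewrite conjc0 mul0r.
case/eqP: hx; apply: val_inj => /=; rewrite addn0 -e' /= [LHS](divn_eq _ (2 ^ a)) e addn0 //.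
Qed.

(** With [E] the isometry adjoining zero ancillas, [C E = E U] and hence [U = E^* C E]; both claims
    pass from [C] to [U]. *)
Lemma represented_unitary_R16 m a (U : 'M[CC]_(2 ^ m)) : represented_with 16 m a U ->
  unitary U /\ forall i j, in_Rn 16 (U i j).
Proof.
move=> [cir h]; set C := circuit_mx 16 cir in h.
have cC : circ C by exists cir.
have e : C *m anc_mx m a = anc_mx m a *m U.
  by apply: eq_mx_act => v; rewrite -!mulmxA -!tens_e0E.
have eU : U = ctmx (anc_mx m a) *m (C *m anc_mx m a) by rewrite e mulmxA anc_isometry mul1mx.
have hE x u : in_Rn 16 (anc_mx m a x u) by rewrite mxE; case: (_ && _); [exact: in_Rn1|exact: in_Rn0].
split.
- rewrite /unitary -/(ctmx _); apply: mulmx1C.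
  rewrite -[ctmx U]mulmx1 -(anc_isometry m a) mulmxA -ctmxM -[LHS]mulmxA -e ctmxM -mulmxA (mulmxA
    (ctmx C)).
  by rewrite (unitary_ctmxl _ _ (circ_unitary _ _ cC)) mul1mx anc_isometry.
- rewrite eU; apply: in_Rn_mulmx; last by apply: in_Rn_mulmx => //; exact: circ_R16.
  move=> x y; rewrite ctmxE mxE conjc_nat; by case: (_ && _); [exact: in_Rn1|exact: in_Rn0].
Qed.

(** * The catalytic embedding *)

Definition R16 (x : CC) := exists a b, [/\ R8 a, R8 b & x = a + z16 * b].

(** By minimality: [R16] is a subring, its products closing up through [z16 ^+ 2 = w], and contains
    both generators. *)
Lemma in_R16_split x : in_Rn 16 x -> R16 x.
Proof.
have R81 : R8 1 := Zw_R8 _ Zw1.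
have R80 : R8 0 := Zw_R8 _ Zw0.
pose S := [pred y | `[< R16 y >]].
move=> /(_ S) h; apply/asboolP; apply: h.
- split.
  + by apply/asboolP; exists 1, 0; split=> //; rewrite mulr0 addr0.
  + move=> _ _ /asboolP[a [b [ha hb ->]]] /asboolP[c [d [hc hd ->]]]; apply/asboolP.
    by exists (a - c), (b - d); split; [exact: R8D (R8N _ hc)|exact: R8D (R8N _ hd)|ring].
  + move=> _ _ /asboolP[a [b [ha hb ->]]] /asboolP[c [d [hc hd ->]]]; apply/asboolP.
    exists (a * c + w * (b * d)), (a * d + b * c); split; last by rewrite wE; ring.
      by apply: R8D; apply: R8M => //; [exact: Zw_R8 Zww|exact: R8M].
    by apply: R8D; apply: R8M.
- by apply/asboolP; exists (1 / 2), 0; split=> //; [exact: R8_half|rewrite mulr0 addr0].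
- by apply/asboolP; exists 0, 1; split=> //; rewrite mulr1 add0r.
Qed.

Section Catalysis.
Context {m : nat}.
Implicit Types (u : 'I_(2 ^ m)) (x y : 'I_(2 ^ (m + 1))) (v : 'cV[CC]_(2 ^ m))
  (A B U : 'M[CC]_(2 ^ m)).

Definition data0 u : 'I_(2 ^ (m + 1)) := pack m 1 u (Ordinal (isT : 0 < 2 ^ 1)%N).
Definition data1 u : 'I_(2 ^ (m + 1)) := pack m 1 u (Ordinal (isT : 1 < 2 ^ 1)%N).

Lemma odd_data0 u : odd (data0 u) = false.
Proof. by rewrite /= oddD oddM expn1 andbF. Qed.

Lemma odd_data1 u : odd (data1 u) = true.
Proof. by rewrite /= oddD oddM expn1 andbF. Qed.

Lemma hi_data0 u : hi_idx (data0 u) = u. Proof. exact: hi_pack. Qed.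
Lemma hi_data1 u : hi_idx (data1 u) = u. Proof. exact: hi_pack. Qed.

Lemma hi_odd_inj x y : hi_idx x = hi_idx y -> odd x = odd y -> x = y.
Proof.
move=> /(congr1 val) /= h o; apply: val_inj => /=; move: h.
by rewrite expn1 !divn2 => h; rewrite -(odd_double_half x) o h odd_double_half.
Qed.

Lemma data_cases x : x = if odd x then data1 (hi_idx x) else data0 (hi_idx x).
Proof. by apply: hi_odd_inj; case: ifP => e; rewrite ?hi_data0 ?hi_data1 ?odd_data0 ?odd_data1. Qed.

Lemma sum_ancilla (F : 'I_(2 ^ (m + 1)) -> CC) : \sum_x F x = \sum_u (F (data0 u) + F (data1 u)).
Proof.
rewrite (partition_big (@hi_idx m 1) xpredT) //=; apply: eq_bigr => u _.
have n01 : data1 u != data0 u by apply/eqP => /(congr1 (fun x : 'I__ => odd x));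
  rewrite odd_data0 odd_data1.
rewrite (bigD1 (data0 u)) ?hi_data0 //= (bigD1 (data1 u)) ?hi_data1 ?eqxx //= big1 ?addr0 //.
move=> x /andP[/andP[/eqP hx x0] x1]; move: x0 x1; rewrite (data_cases x) hx.
by case: ifP => _; rewrite eqxx.
Qed.

Lemma anc_subproof : (0 < m + 1)%N. Proof. by rewrite addn1. Qed.

Definition anc : 'I_(m + 1) := Ordinal anc_subproof.

Lemma bit_anc x : bit anc x = odd x. Proof. by rewrite /bit expn0 divn1. Qed.

Lemma flip_anc_data0 u : flip anc (data0 u) = data1 u.
Proof.
apply: bit_inj => j; rewrite bit_flip.
case: (j =P anc) => [->|ja]; first by rewrite !bit_anc odd_data0 odd_data1.
have j0 : (0 < j)%N by rewrite lt0n; apply/eqP => j0; apply: ja; exact: val_inj.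
by rewrite addbF /bit -(prednK j0) expnS !divnMA /= !expn1 !divnMDl.
Qed.

Definition block_embed A B : 'M[CC]_(2 ^ (m + 1)) :=
  \matrix_(x, y) if odd x == odd y then A (hi_idx x) (hi_idx y)
    else (if odd x then w else 1) * B (hi_idx x) (hi_idx y).

Definition catalyst v : 'cV[CC]_(2 ^ (m + 1)) :=
  \col_x (hf * v (hi_idx x) 0 * (if odd x then z16 else 1)).

Lemma block_embed_catalyst A B v :
  block_embed A B *m catalyst v = catalyst ((A + z16 *: B) *m v).
Proof.
apply/matrixP => x z; rewrite ord1 !mxE sum_ancilla mulr_sumr mulr_suml.
apply: eq_bigr => u _; rewrite !mxE odd_data0 odd_data1 hi_data0 hi_data1.
by case: (odd x) => /=; rewrite ?wE; ring.
Qed.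

Lemma block_embed_unitary A B : (forall i j, R8 (A i j)) -> (forall i j, R8 (B i j)) ->
  unitary (A + z16 *: B) -> unitary (block_embed A B).
Proof.
move=> hA hB hU.
pose S (M N : 'M[CC]_(2 ^ m)) a b := \sum_u M a u * conjc (N b u).
have hS (M N : 'M[CC]_(2 ^ m)) a b : (forall i j, R8 (M i j)) -> (forall i j, R8 (N i j)) -> R8 (S
  M N a b).
  by move=> hM hN; apply: R8_sum => u _; apply: R8M => //; exact: R8_conj.
have zw : w ^-1 * z16 = z16 ^-1.
  by rewrite wE expr2 invfM -mulrA mulVf ?mulr1 // z16_neq0.
have split_eq a b : S A A a b + S B B a b = (a == b)%:R /\ S B A a b + w ^-1 * S A B a b = 0.
  have := congr1 (fun M : 'M_(2 ^ m) => M a b) hU; rewrite !mxE => e.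
  have e' : (S A A a b + S B B a b - (a == b)%:R) + z16 * (S B A a b + w ^-1 * S A B a b) = 0.
    rewrite -e /S !mulr_sumr -!big_split /= mulr_sumr -sumrB -big_split big1 //= => u _.
    rewrite !mxE conjcD conjcM conj_z16 -zw.
    have zz : z16 * (w ^-1 * z16) = 1 by rewrite zw mulfV // z16_neq0.
    transitivity ((1 - z16 * (w ^-1 * z16)) * (B a u * conjc (B b u))); first by ring.
    by rewrite zz subrr mul0r.
  have [||h1 h2] := R8_z16_free _ _ _ _ e'.
  - by apply: R8D; [apply: R8D; exact: hS|apply: R8N; exact: R8_nat].
  - apply: R8D; first exact: hS; apply: R8M; last exact: hS.
    by rewrite wV; apply: R8N; exact: R8_wX.
  by split=> //; apply/eqP; rewrite -subr_eq0 h1.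
rewrite /unitary -/(ctmx _); apply/matrixP => x y.
rewrite mxE sum_ancilla mxE.
under eq_bigr => u _ do rewrite !ctmxE !mxE odd_data0 odd_data1 hi_data0 hi_data1.
have [h1 h2] := split_eq (hi_idx x) (hi_idx y).
have ww : w * conjc w = 1 by rewrite conj_w mulfV // w_neq0.
case ox: (odd x); case oy: (odd y) => /=.
- have -> : (x == y) = (hi_idx x == hi_idx y).
    by apply/eqP/eqP => [->//|h]; apply: hi_odd_inj; rewrite // ox oy.
  rewrite -h1 /S -big_split; apply: eq_bigr => u _ /=; rewrite conjcM.
  by ring: ww.
- have -> : (x == y) = false by apply/eqP => h; move: ox; rewrite h oy.
  transitivity (w * (S B A (hi_idx x) (hi_idx y) + w ^-1 * S A B (hi_idx x) (hi_idx y)));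
    last by rewrite h2 mulr0.
  rewrite mulrDr mulrA mulfV ?w_neq0 // mul1r /S mulr_sumr -big_split; apply: eq_bigr => u _ /=.
  by rewrite mul1r; ring.
- have -> : (x == y) = false by apply/eqP => h; move: ox; rewrite h oy.
  rewrite -[RHS]h2 /S mulr_sumr -big_split; apply: eq_bigr => u _ /=.
  by rewrite conjcM conj_w mul1r; ring.
- have -> : (x == y) = (hi_idx x == hi_idx y).
    by apply/eqP/eqP => [->//|h]; apply: hi_odd_inj; rewrite // ox oy.
  rewrite -h1 /S -big_split; apply: eq_bigr => u _ /=; rewrite conjcM conjc1.
  by ring.
Qed.
End Catalysis.

Section SingleAncilla.
Context {m : nat}.
Implicit Types (u : 'I_(2 ^ m)) (x y : 'I_(2 ^ (m + 1))) (v : 'cV[CC]_(2 ^ m))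
  (A B U V : 'M[CC]_(2 ^ m)).

Lemma tens_data0 v u : tens_e0 1 v (data0 u) 0 = v u 0.
Proof. by rewrite mxE hi_data0 expn1 modn2 odd_data0. Qed.

Lemma tens_data1 v u : tens_e0 1 v (data1 u) 0 = 0.
Proof. by rewrite mxE expn1 modn2 odd_data1. Qed.

Lemma flip_anc_data1 u : flip anc (data1 u) = data0 u.
Proof. by rewrite -flip_anc_data0 flipK. Qed.

Lemma data01_neq u u' : (data0 u == data1 u') = false.
Proof. by apply/eqP => /(congr1 (fun x : 'I__ => odd x)); rewrite odd_data0 odd_data1. Qed.

Lemma eq_data0 u u' : (data0 u == data0 u') = (u == u').
Proof. by apply/eqP/eqP => [/(congr1 (@hi_idx m 1))|->//]; rewrite !hi_data0. Qed.

Lemma eq_data1 u u' : (data1 u == data1 u') = (u == u').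
Proof. by apply/eqP/eqP => [/(congr1 (@hi_idx m 1))|->//]; rewrite !hi_data1. Qed.

Lemma ancilla_ext (s t : 'cV[CC]_(2 ^ (m + 1))) :
  (forall u, s (data0 u) 0 = t (data0 u) 0) -> (forall u, s (data1 u) 0 = t (data1 u) 0) -> s = t.
Proof. by move=> h0 h1; apply/matrixP => x z; rewrite ord1 (data_cases x); case: ifP. Qed.

Definition synthesizable U :=
  exists C, circ C /\ forall v, C *m tens_e0 1 v = tens_e0 1 (U *m v).

Lemma synthesizableM U V : synthesizable U -> synthesizable V -> synthesizable (U *m V).
Proof.
move=> [C [cC hC]] [D [cD hD]]; exists (C *m D); split; first exact: circM.
by move=> v; rewrite -!mulmxA hD hC.
Qed.

Lemma one_levelM n (l : 'I_n) a b : one_level l a *m one_level l b = one_level l (a * b).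
Proof.
apply: eq_mx_act => v; apply/matrixP => x z; rewrite -mulmxA !one_level_act.
by case: ifP; rewrite ?mul1r ?mulrA.
Qed.

Lemma one_level1 n (l : 'I_n) : one_level l 1 = 1%:M.
Proof.
by apply: eq_mx_act => v; apply/matrixP => x z; rewrite one_level_act if_same mul1mx mul1r.
Qed.

Lemma data0_neq_data1 u : data0 u != data1 u. Proof. by rewrite data01_neq. Qed.

(* Multiplying by [mixer s] twice is a phased swap of the two levels: it moves the state [u]
   to the ancilla value 1, where a single [T] gate can see it. *)
Lemma synthesizable_phase u : (0 < m)%N -> synthesizable (one_level u z16).
Proof.
move=> m0; have k1 : (1 < m + 1)%N by rewrite addn1 ltnS.
have cm s : circ (mixer s (data0 u) (data1 u)) by apply: mixable_all => //; exact: data0_neq_data1.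
exists (mixer 4 (data0 u) (data1 u) *m mixer 4 (data0 u) (data1 u) *m zdiag (fun x => bit (@anc m) x)
  *m (mixer 0 (data0 u) (data1 u) *m mixer 0 (data0 u) (data1 u))); split.
  by do ?apply: circM => //; exact: circ_T.
move=> v; rewrite -!mulmxA.
apply: ancilla_ext => u'; rewrite mixer_sq ?data0_neq_data1 // !zdiag_act !mixer_sq ?data0_neq_data1 //.
- rewrite !eqxx !data01_neq [data1 u == _]eq_sym data01_neq eq_data0 !tens_data0 !tens_data1
    one_level_act !bit_anc.
  rewrite !odd_data0 !odd_data1 w4 expr1 expr0 ?w4 ?mul1r.
  by case: eqP => [->|_]; rewrite ?mul1r //; ring.
- rewrite !eqxx ![data1 _ == data0 _]eq_sym !data01_neq eq_data1 !tens_data0 !tens_data1 !bit_anc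
    !odd_data0 !odd_data1.
  by case: eqP => _; rewrite !mulr0.
Qed.

Lemma synthesizable_phaseX u n : (0 < m)%N -> synthesizable (one_level u (z16 ^+ n)).
Proof.
move=> m0; elim: n => [|n IH].
  by rewrite one_level1; exists 1%:M; split; [exact: circ1|move=> v; rewrite !mul1mx].
rewrite exprS -one_levelM; apply: synthesizableM => //; exact: synthesizable_phase.
Qed.

Lemma prepare_catalyst v : zdiag (fun x => bit (@anc m) x) *m hmx (@anc m) *m tens_e0 1 v = catalyst v.
Proof.
apply: ancilla_ext => u; rewrite -mulmxA zdiag_act hmx_act bit_anc.
  by rewrite flip_anc_data0 tens_data0 tens_data1 mxE hi_data0 odd_data0; ring.
by rewrite flip_anc_data1 tens_data0 tens_data1 mxE hi_data1 odd_data1; ring.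
Qed.

Lemma synthesizable_catalyst U C : circ C ->
  (forall v, C *m catalyst v = catalyst (U *m v)) -> synthesizable U.
Proof.
move=> cC hC; pose K : 'M_(2 ^ (m + 1)) := zdiag (fun x => bit (@anc m) x) *m hmx (@anc m).
have [K' [cK' e _]] : exists K', [/\ circ K', K' *m K = 1%:M & K *m K' = 1%:M].
  by apply: circ_inv; apply: circM; [exact: circ_T|exact: circ_hmx].
exists (K' *m C *m K); split.
  by do ?apply: circM => //; [exact: circ_T|exact: circ_hmx].
move=> v; have eK v' : K *m tens_e0 1 v' = catalyst v' by exact: prepare_catalyst.
by rewrite -mulmxA eK -mulmxA hC -eK mulmxA e mul1mx.
Qed.

Lemma catalyst_data0 v u : catalyst v (data0 u) 0 = hf * v u 0.
Proof. by rewrite mxE hi_data0 odd_data0 mulr1. Qed.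

Lemma catalyst_data1 v u : catalyst v (data1 u) 0 = hf * v u 0 * z16.
Proof. by rewrite mxE hi_data1 odd_data1. Qed.

(* A phase [w ^+ s] on [data0 u] has the wrong determinant for the mixers; on catalysed states
   the phase [z16 ^+ (3 * s)] on [u] compensates it. *)
Lemma catalytic_phase u s : (0 < m)%N -> exists Z, circ Z /\
  forall v, Z *m catalyst v =
    one_level (data0 u) (w ^+ s) *m catalyst (one_level u (z16 ^+ (3 * s)) *m v).
Proof.
move=> m0; have k1 : (1 < m + 1)%N by rewrite addn1 ltnS.
have cm t : circ (mixer t (data0 u) (data1 u)) by apply: mixable_all => //; exact: data0_neq_data1.
(* Catalysed entries at [data0 u] and [data1 u] differ by a factor [z16], so a swap produces the odd
   power of [z16] needed for odd [s]; at [s = 2a + 1] its phase is [w ^+ (s + 3a + 1)]. At [s = 2a]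
   the two swaps compose to the diagonal [w ^+ (5a)], [w ^+ (3a)]. *)
rewrite -(odd_double_half s); set a := s./2; case: (odd s) => /=.
- exists (mixer (5 * a + 2) (data0 u) (data1 u) *m mixer (5 * a + 2) (data0 u) (data1 u)); split.
    by apply: circM.
  move=> v; rewrite -mulmxA; apply: ancilla_ext => u';
    rewrite mixer_sq ?data0_neq_data1 // !one_level_act.
  + rewrite eq_data0 !data01_neq !catalyst_data0 !catalyst_data1 one_level_act.
    case: eqP => [->|_]; last by rewrite !mul1r.
    have -> : w ^+ (5 * a + 2) = w ^+ (1 + a.*2) * w ^+ (3 * a + 1).
      by rewrite -exprD; congr (_ ^+ _); lia.
    have -> : (3 * (1 + a.*2) = 2 * (3 * a + 1) + 1)%N by lia.
    by rewrite [z16 ^+ (_ + 1)]exprD z16_even expr1; ring.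
  + rewrite ![data1 _ == data0 _]eq_sym !data01_neq eq_data1 !catalyst_data0 !catalyst_data1
      one_level_act mul1r.
    case: eqP => [->|_]; last by rewrite !mul1r.
    have -> : w ^+ (7 * (5 * a + 2) + 4) = w ^+ (3 * a + 1) * w.
      by rewrite -exprSr; apply: wX_mod8; apply/eqP; lia.
    have -> : (3 * (1 + a.*2) = 2 * (3 * a + 1) + 1)%N by lia.
    by rewrite [z16 ^+ (_ + 1)]exprD z16_even expr1; ring: (esym wE).
- exists (mixer (5 * a + 4) (data0 u) (data1 u) *m mixer (5 * a + 4) (data0 u) (data1 u)
    *m (mixer 0 (data0 u) (data1 u) *m mixer 0 (data0 u) (data1 u))); split.
    by do ?apply: circM.
  have e6 : (3 * (0 + a.*2) = 2 * (3 * a))%N by lia.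
  move=> v; rewrite -!mulmxA; apply: ancilla_ext => u';
    rewrite mixer_sq ?data0_neq_data1 // !mixer_sq ?data0_neq_data1 // !one_level_act.
  + rewrite !eqxx eq_data0 !data01_neq [data1 u == data0 u]eq_sym data01_neq !catalyst_data0
      one_level_act e6 z16_even.
    case: eqP => [->|_]; last by rewrite !mul1r.
    have e : w ^+ (5 * a + 4) * w ^+ (7 * 0 + 4) = w ^+ (0 + a.*2) * w ^+ (3 * a).
      by rewrite -!exprD; apply: wX_mod8; apply/eqP; lia.
    by rewrite mulrA e; ring.
  + rewrite !eqxx ![data1 _ == data0 _]eq_sym !data01_neq eq_data1 !catalyst_data1 one_level_act e6
      z16_even !mul1r.
    case: eqP => [->|_]; last by rewrite !mul1r.
    have -> : w ^+ (7 * (5 * a + 4) + 4) = w ^+ (3 * a).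
      by apply: wX_mod8; apply/eqP; lia.
    by ring.
Qed.

Lemma R16_unitary_synthesizable U : (0 < m)%N -> unitary U ->
  (forall i j, in_Rn 16 (U i j)) -> synthesizable U.
Proof.
move=> m0 hU hR.
have [A [B [hA hB eU]]] : exists A B, [/\ forall i j, R8 (A i j), forall i j, R8 (B i j)
    & U = A + z16 *: B].
  have /fin_all_exists[f hf] : forall p : 'I_(2 ^ m) * 'I_(2 ^ m), exists q : CC * CC,
      [/\ R8 q.1, R8 q.2 & U p.1 p.2 = q.1 + z16 * q.2].
    by move=> p; have [a [b h]] := in_R16_split _ (hR p.1 p.2); exists (a, b).
  exists (\matrix_(i, j) (f (i, j)).1), (\matrix_(i, j) (f (i, j)).2); split.
  - by move=> i j; rewrite mxE; case: (hf (i, j)).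
  - by move=> i j; rewrite mxE; case: (hf (i, j)).
  - by apply/matrixP => i j; rewrite !mxE; case: (hf (i, j)).
rewrite eU in hU; have hPhi := block_embed_unitary A B hA hB hU; rewrite -eU in hU.
have hRP x y : R8 (block_embed A B x y).
  rewrite mxE; case: ifP => _ //; apply: R8M => //; case: ifP => _; exact: Zw_R8 Zww || exact: R8_nat 1.
have u : 'I_(2 ^ m) by exact: (Ordinal (expn_gt0 2 m : 0 < 2 ^ m)%N).
have [||W [s [hW eW]]] := reduce_unitary setT (data0 u) _ _ hPhi hRP.
- by rewrite inE.
- by move=> j; rewrite inE.
have k1 : (1 < m + 1)%N by rewrite addn1 ltnS.
have [W' [cW' e _]] := circ_inv _ (circ_mixer_gen _ _ k1 hW).
have [Z [cZ hZ]] := catalytic_phase u s m0.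
(* The embedding is [W'] times the leftover phase, and [Z] supplies that phase at the price of
   [z16 ^+ (3 * s)] on the data. So [W' Z] realises [U] times this phase, which its inverse, of
   exponent [15 * (3 * s)], cancels after the catalyst is uncomputed. *)
have cat v : W' *m Z *m catalyst v = catalyst (U *m one_level u (z16 ^+ (3 * s)) *m v).
  rewrite -mulmxA hZ -eW -!mulmxA (mulmxA W') e mul1mx block_embed_catalyst -eU.
  by rewrite -?mulmxA.
have sU := synthesizable_catalyst _ _ (circM _ _ cW' cZ) cat.
have := synthesizableM _ _ sU (synthesizable_phaseX u (15 * (3 * s)) m0).
rewrite -mulmxA one_levelM -exprD -mulSn exprM z16_16 expr1n one_level1 mulmx1 //.
Qed.
End SingleAncilla.

Theorem theorem6p3 (m : nat) (U : 'M[CC]_(2 ^ m)) :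
  (1 <= m)%N ->
  ((exists a : nat, represented_with 16 m a U) <->
     (unitary U /\ forall i j, in_Rn 16 (U i j)))
  /\ ((unitary U /\ forall i j, in_Rn 16 (U i j)) ->
      represented_with 16 m 1 U).
Proof.
move=> m0.
have hard : (unitary U /\ forall i j, in_Rn 16 (U i j)) -> represented_with 16 m 1 U.
  move=> [hU hR]; have [C [[cir <-] h]] := R16_unitary_synthesizable U m0 hU hR.
  by exists cir.
split=> //; split=> [[a h]|h]; first exact: represented_unitary_R16 h.
by exists 1%N; exact: hard.
Qed.
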